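(* Let $\tau\in C_b(\mathbb{R})$, let $\alpha$ be a homeomorphism of $\mathbb{R}$, and let $W=(w_j)_{j\in\mathbb{Z}}$ be a sequence in $C_b(\mathbb{R})$ with $w_j>0$ for all $j$, $\sup_j\|w_j\|_\infty<\infty$ and $\sup_j\|w_j^{-1}\|_\infty<\infty$. Let $T_{\alpha,W}$ be the operator $(T_{\alpha,W}(s))_j=w_j\cdot(s_{j-1}\circ\alpha)$ on ${\rm c}_0^{\mathcal{A},\tau}$. Then the following are equivalent: (1) $T_{\alpha,W}$ is hypercyclic on ${\rm c}_0^{\mathcal{A},\tau}$. (2) For every $J\in\mathbb{N}$, all $\epsilon_{-J},\dots,\epsilon_J\in(0,1)$ and every finite collection $\{K_{-J},K_{-J+1},\dots,K_0,\dots,K_J\}$ of compact subsets of $\mathbb{R}$ with $K_j\subseteq|\tau\circ\alpha^j|^{-1}([0,\epsilon_j])$ for all $-J\le j\le J$, there exists a strictly increasing sequence $(r_k)\subseteq\mathbb{N}$ such that $$\lim_{k\to\infty}\Big(\sup_{t\in K_j}\Big|\prod_{i=1}^{r_k}(w_{i+j}\circ\alpha^{-i})(t)\Big|\Big)=\lim_{k\to\infty}\Big(\sup_{t\in K_j}\Big|\prod_{i=1}^{r_k}(w_{j+1-i}\circ\alpha^{i-1})^{-1}(t)\Big|\Big)=0$$ for all integers $j$ with $-J\le j\le J$.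
   Context: $\mathcal{A}=C_0(\mathbb{R})$ with the sup norm. For $\rho\in C_b(\mathbb{R})$, the Segal algebra $\mathcal{A}_\rho=\{f\in\mathcal{A}:\sum_{k=0}^\infty\|f\rho^k\|_\infty<\infty\}$ is a Banach algebra with norm $\|f\|_\rho=\sum_{k=0}^\infty\|f\rho^k\|_\infty$. Define $${\rm c}_0^{\mathcal{A},\tau}=\Big\{s=(s_k)\in\prod_{k\in\mathbb{Z}}\mathcal{A}_{\tau\circ\alpha^k}:\ \lim_{k\to\infty}\|s_k\|_{\tau\circ\alpha^k}=\lim_{k\to\infty}\|s_{-k}\|_{\tau\circ\alpha^{-k}}=0\Big\},$$ with norm $\|s\|_0=\sup_{k\in\mathbb{Z}}\|s_k\|_{\tau\circ\alpha^k}$. $f^{-1}$ in a product of functions denotes the pointwise reciprocal, while $|\rho|^{-1}(E)$ denotes the preimage of the set $E$ under $|\rho|$; $\alpha^m$ ($m\in\mathbb{Z}$) are iterates of $\alpha$. A bounded operator $T$ on a Banach space $\mathcal{X}$ is hypercyclic if there is $x\in\mathcal{X}$ with $\{T^nx:n\ge0\}$ dense in $\mathcal{X}$. Standing assumption: the Banach space on which the operator acts is separable and infinite-dimensional. A supremum of non-negative quantities over the empty set is $0$. *)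

(* Defs.v *)
From HB Require Import structures.
From mathcomp Require Import all_boot all_order all_algebra complex.
From mathcomp Require Import all_classical all_reals all_analysis.

Set Implicit Arguments.
Unset Strict Implicit.
Unset Printing Implicit Defensive.

Import Order.TTheory GRing.Theory Num.Theory.
Import numFieldNormedType.Exports.

Local Open Scope classical_set_scope.
Local Open Scope ring_scope.
Local Open Scope complex_scope.

(* The usual topology of the complex numbers, transported from the regular
   module [R[i]^o]. *)
HB.instance Definition _ (R : rcfType) := NormedModule.copy R[i] R[i]^o.

(* The real-valued modulus; the library norm of [R[i]] takes values in [R[i]]
   and satisfies [`|z| = (modulus z)%:C]. *)
Notation modulus := ComplexField.Normc.normc.

Section operator_theory.
Variables (K : numFieldType) (X : normedModType K).

Definition separable := exists2 D : set X, countable D & dense D.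

Definition infinite_dimensional :=
  ~ exists n (b : 'I_n -> X), forall x : X,
      exists c : 'I_n -> K, x = \sum_(i < n) c i *: b i.

Definition hypercyclic (T : {linear X -> X}) :=
  exists x : X, dense [set iter n T x | n in [set: nat]].

End operator_theory.
Arguments separable {K} X.
Arguments infinite_dimensional {K} X.

Record homeo (R : realType) := Homeo {
  homeo_fun :> R -> R;
  homeo_inv : R -> R;
  homeoK : cancel homeo_fun homeo_inv;
  homeo_invK : cancel homeo_inv homeo_fun;
  homeo_continuous : continuous homeo_fun;
  homeo_inv_continuous : continuous homeo_inv }.

Definition homeo_iter (R : realType) (alpha : homeo R) (m : int) : R -> R :=
  match m with
  | Posz n => iter n alpha
  | Negz n => iter n.+1 (homeo_inv alpha)
  end.

Section function_spaces.
Variable R : realType.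
Implicit Types (f g rho : R -> R[i]).

Definition supnorm f : \bar R :=
  ereal_sup [set (modulus (f x))%:E | x in [set: R]].

Definition Cb : set (R -> R[i]) :=
  [set f | continuous f /\ (supnorm f < +oo)%E].

Definition C0 : set (R -> R[i]) :=
  [set f | continuous f /\
    forall e : R, 0 < e -> exists2 K : set R, compact K &
      forall x, ~ K x -> modulus (f x) < e].

Definition segal_norm rho f : \bar R :=
  (\sum_(0 <= k <oo) supnorm (fun x => f x * rho x ^+ k)%R)%E.

Definition segal rho : set (R -> R[i]) :=
  [set f | C0 f /\ (segal_norm rho f < +oo)%E].

End function_spaces.

Section c0_definition.
Variables (R : realType) (tau : R -> R[i]) (alpha : homeo R).

Definition seq_norm (s : int -> R -> R[i]) (k : int) : \bar R :=
  segal_norm (tau \o homeo_iter alpha k) (s k).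

Definition c0_set : set (int -> R -> R[i]) :=
  [set s | [/\ forall k : int, segal (tau \o homeo_iter alpha k) (s k),
    (fun n : nat => seq_norm s n%:Z) @ \oo --> 0%E &
    (fun n : nat => seq_norm s (- n%:Z)) @ \oo --> 0%E]].

Definition c0_pred : {pred int -> R -> R[i]} := mem c0_set.

Record c0 := MkC0 { c0_seq :> int -> R -> R[i]; _ : c0_seq \in c0_pred }.

HB.instance Definition _ := [isSub for c0_seq].
HB.instance Definition _ := [Choice of c0 by <:].

Definition c0_norm (s : c0) : R :=
  fine (ereal_sup [set seq_norm s k | k in [set: int]]).

End c0_definition.

Section function_space_theory.
Variable R : realType.
Implicit Types (f g rho : R -> R[i]).
Local Open Scope ereal_scope.

Lemma modulusE (z : R[i]) : `|z|%R = (modulus z)%:C%C.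
Proof. by []. Qed.

Lemma modulus_ge0 (z : R[i]) : (0 <= modulus z)%R.
Proof. by case: z => a b /=; exact: sqrtr_ge0. Qed.

Lemma modulusD (z w : R[i]) : (modulus (z + w) <= modulus z + modulus w)%R.
Proof. exact: le_normcD. Qed.

Lemma supnorm_ub f x : (modulus (f x))%:E <= supnorm f.
Proof. by apply: ereal_sup_ubound; exists x. Qed.

Lemma supnorm_le f M : (forall x, (modulus (f x))%:E <= M) -> supnorm f <= M.
Proof. by move=> fM; apply: ge_ereal_sup => _ [x _ <-]. Qed.

Lemma supnorm_ge0 f : 0 <= supnorm f.
Proof. by apply: le_trans (supnorm_ub f 0%R); rewrite lee_fin modulus_ge0. Qed.

Lemma supnormD f g : supnorm (fun x => f x + g x)%R <= supnorm f + supnorm g.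
Proof.
apply: supnorm_le => x; apply: le_trans (leeD (supnorm_ub f x) (supnorm_ub g x)).
by rewrite -EFinD lee_fin modulusD.
Qed.

Lemma segal_norm_ge0 rho f : 0 <= segal_norm rho f.
Proof. by apply: nneseries_ge0 => *; exact: supnorm_ge0. Qed.

Lemma supnorm_le_segal_norm rho f : supnorm f <= segal_norm rho f.
Proof.
rewrite /segal_norm nneseries_recl//; last by move=> *; exact: supnorm_ge0.
have -> : (fun x => f x * rho x ^+ 0)%R = f.
  by apply/funext => x; rewrite expr0 mulr1.
by rewrite leeDl// nneseries_ge0// => *; exact: supnorm_ge0.
Qed.

Lemma segal_normD rho f g :
  segal_norm rho (fun x => f x + g x)%R <= segal_norm rho f + segal_norm rho g.
Proof.
rewrite /segal_norm -nneseriesD; try by move=> *; exact: supnorm_ge0.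
apply: lee_nneseries => [*|n _]; first exact: supnorm_ge0.
apply: le_trans (supnormD _ _); rewrite le_eqVlt; apply/orP; left; apply/eqP.
by congr supnorm; apply/funext => x; rewrite mulrDl.
Qed.

Lemma segal_norm_weight rho f (w : R -> R[i]) (a : R -> R) (M : R) :
  (forall x, (modulus (w x) <= M)%R) ->
  segal_norm (rho \o a) (fun x => w x * f (a x))%R <= M%:E * segal_norm rho f.
Proof.
move=> wM; have M0 : (0 <= M)%R by apply: le_trans (wM 0%R); exact: modulus_ge0.
rewrite /segal_norm -nneseriesZl; last by move=> *; exact: supnorm_ge0.
apply: lee_nneseries => [*|n _]; first exact: supnorm_ge0.
apply: supnorm_le => x /=; rewrite -mulrA ComplexField.Normc.normcM EFinM.
apply: lee_pmul; rewrite ?lee_fin ?modulus_ge0//.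
exact: (supnorm_ub (fun y => f y * rho y ^+ n)%R).
Qed.

Lemma segal_normZ rho f (c : R[i]) :
  segal_norm rho (fun x => c * f x)%R <= (modulus c)%:E * segal_norm rho f.
Proof. exact: (@segal_norm_weight rho f (cst c) id). Qed.

Lemma C0D f g : C0 f -> C0 g -> C0 (fun x => f x + g x)%R.
Proof.
move=> [cf f0] [cg g0]; split=> [x|e e0]; first exact: cvgD (cf x) (cg x).
have e20 : (0 < e / 2)%R by rewrite divr_gt0.
have [K cK fK] := f0 _ e20; have [L cL gL] := g0 _ e20.
exists (K `|` L) => [|x /not_orP[nK nL]]; first exact: compactU.
by rewrite (le_lt_trans (modulusD _ _))// [ltRHS]splitr ltrD// ?fK ?gL.
Qed.

Lemma C0_weight f (w : R -> R[i]) (a b : R -> R) (M : R) :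
  continuous w -> continuous a -> continuous b -> cancel a b ->
  (forall x, (modulus (w x) <= M)%R) -> C0 f ->
  C0 (fun x => w x * f (a x))%R.
Proof.
move=> cw ca cb abK wM [cf f0]; split=> [x|e e0].
  apply: (@cvgM R[i] R _ _ w (f \o a)); first exact: cw.
  exact: continuous_comp (ca x) (cf (a x)).
have M0 : (0 <= M)%R by apply: le_trans (wM 0%R); exact: modulus_ge0.
have M1 : (0 < M + 1)%R by rewrite ltr_wpDl.
have [K cK fK] := f0 _ (divr_gt0 e0 M1).
exists (b @` K) => [|x nKx].
  by apply: continuous_compact => //; exact: continuous_subspaceT.
have {}/fK fax : ~ K (a x) by move=> Kax; apply: nKx; exists (a x).
rewrite ComplexField.Normc.normcM.
have : (modulus (w x) * modulus (f (a x)) <= (M + 1) * modulus (f (a x)))%R.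
  by rewrite ler_wpM2r ?modulus_ge0// (le_trans (wM x))// lerDl.
by move=> /le_lt_trans; apply; rewrite mulrC -ltr_pdivlMr.
Qed.

Lemma segalD rho f g :
  segal rho f -> segal rho g -> segal rho (fun x => f x + g x)%R.
Proof.
move=> [f0 fr] [g0 gr]; split; first exact: C0D.
by apply: le_lt_trans (segal_normD _ _ _) _; exact: lte_add_pinfty.
Qed.

Lemma segal_weight rho f (w : R -> R[i]) (a b : R -> R) (M : R) :
  continuous w -> continuous a -> continuous b -> cancel a b ->
  (forall x, (modulus (w x) <= M)%R) -> segal rho f ->
  segal (rho \o a) (fun x => w x * f (a x))%R.
Proof.
move=> cw ca cb abK wM [f0 fr]; split; first exact: C0_weight cb abK wM f0.
apply: le_lt_trans (segal_norm_weight rho f a wM) _.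
have /fineK <- : segal_norm rho f \is a fin_num.
  by rewrite ge0_fin_numE// segal_norm_ge0.
by rewrite -EFinM ltry.
Qed.

Lemma segalZ rho f (c : R[i]) : segal rho f -> segal rho (fun x => c * f x)%R.
Proof.
apply: (@segal_weight rho f (cst c) id id (modulus c)).
- by move=> x; exact: cvg_cst.
- by move=> x; exact: cvg_id.
- by move=> x; exact: cvg_id.
- by [].
- by [].
Qed.

End function_space_theory.

Section c0_theory.
Variables (R : realType) (tau : R -> R[i]) (alpha : homeo R).
Local Notation c0_set := (c0_set tau alpha).
Local Notation c0 := (c0 tau alpha).
Local Notation N := (seq_norm tau alpha).
Local Open Scope ereal_scope.

Lemma seq_norm_ge0 s k : 0 <= N s k.
Proof. exact: segal_norm_ge0. Qed.

Lemma squeeze0 (u v : nat -> \bar R) :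
  (forall n, 0 <= u n <= v n) -> v @ \oo --> 0 -> u @ \oo --> 0.
Proof.
move=> uv v0; apply: (@squeeze_cvge _ _ _ _ (cst 0) _ v) => //.
  exact: nearW.
exact: cvg_cst.
Qed.

Lemma cvge0Zl (c : R) (u : nat -> \bar R) :
  u @ \oo --> 0 -> (fun n => c%:E * u n) @ \oo --> 0.
Proof. by move=> /(cvgeZl (isT : c%:E \is a fin_num)); rewrite mule0. Qed.

Lemma cvge0D (u v : nat -> \bar R) :
  u @ \oo --> 0 -> v @ \oo --> 0 -> (fun n => u n + v n) @ \oo --> 0.
Proof.
move=> u0 v0; have := @cvgeD _ \oo _ R u v 0 0 isT u0 v0; rewrite adde0.
exact.
Qed.

Lemma segal_norm0 rho : segal_norm rho (fun=> 0%R : R[i]) = 0.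
Proof.
apply/eqP; rewrite eq_le segal_norm_ge0 andbT.
have := segal_normZ rho (fun=> 0%R) 0%R.
rewrite ComplexField.Normc.normc0 mul0e; apply: le_trans.
rewrite le_eqVlt; apply/orP; left; apply/eqP; congr segal_norm.
by apply/funext => x; rewrite mulr0.
Qed.

Lemma segal0 rho : segal rho (fun=> 0%R : R[i]).
Proof.
split; last by rewrite segal_norm0 ltry.
split=> [x|e e0]; first exact: cvg_cst.
by exists set0 => [|x _]; [exact: compact0|rewrite ComplexField.Normc.normc0].
Qed.

Lemma c0_submod_closed : submod_closed (c0_pred tau alpha).
Proof.
have hZ c s : s \in c0_pred tau alpha -> c *: s \in c0_pred tau alpha.
  rewrite !inE => -[h p n]; have h' k := segal_normZ (tau \o homeo_iter alpha k) (s k) c.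
  have Z (u : nat -> int) : (fun n => N s (u n)) @ \oo --> 0 ->
      (fun n => N (c *: s) (u n)) @ \oo --> 0.
    move=> su; apply: (@squeeze0 _ (fun n => (modulus c)%:E * N s (u n))).
      by move=> m; rewrite seq_norm_ge0/=; exact: h'.
    exact: cvge0Zl.
  split.
  - by move=> k; exact (segalZ c (h k)).
  - exact (Z (fun n => n%:Z) p).
  - exact (Z (fun n => (- n%:Z)%R) n).
have hD s t : s \in c0_pred tau alpha -> t \in c0_pred tau alpha -> (s + t)%R \in c0_pred tau alpha.
  rewrite !inE => -[h1 p1 n1] [h2 p2 n2].
  have D (u : nat -> int) : (fun n => N s (u n)) @ \oo --> 0 ->
      (fun n => N t (u n)) @ \oo --> 0 ->
      (fun n => N (s + t)%R (u n)) @ \oo --> 0.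
    move=> su tu; apply: (@squeeze0 _ (fun n => N s (u n) + N t (u n))).
      by move=> m; rewrite seq_norm_ge0/=; exact: segal_normD.
    exact: cvge0D.
  split.
  - by move=> k; exact (segalD (h1 k) (h2 k)).
  - exact (D (fun n => n%:Z) p1 p2).
  - exact (D (fun n => (- n%:Z)%R) n1 n2).
split=> [|c s t hs ht].
  have Z (u : nat -> int) : (fun n => N (fun=> (fun=> 0%R)) (u n)) @ \oo --> 0.
    rewrite (_ : (fun _ => _) = cst 0); first exact: cvg_cst.
    by apply/funext => n; exact: segal_norm0.
  rewrite inE; split.
  - by move=> k; exact: segal0.
  - exact (Z (fun n => n%:Z)).
  - exact (Z (fun n => (- n%:Z)%R)).
by apply: hD => //; exact: hZ.
Qed.

HB.instance Definition _ :=
  GRing.isSubmodClosed.Build _ _ (c0_pred tau alpha) c0_submod_closed.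
HB.instance Definition _ := [SubChoice_isSubLmodule of c0 by <:].

Lemma c0P (s : c0) : c0_set s.
Proof. by apply: set_mem; exact: (valP s). Qed.

Lemma seq_norm_fin_num (s : c0) k : N s k \is a fin_num.
Proof.
by rewrite ge0_fin_numE ?seq_norm_ge0//; have [/(_ k)[]] := c0P s.
Qed.

Lemma cvg0_ubound (u : nat -> \bar R) : (forall n, u n \is a fin_num) ->
  u @ \oo --> 0 -> exists M : R, forall n, u n <= M%:E.
Proof.
move=> uf u0; have fu : cvgn (fine \o u) by apply/cvg_ex; exists 0%R; exact: fine_cvg.
have [M [_ /(_ (M + 1)%R)]] := cvg_seq_bounded fu.
rewrite ltrDl ltr01 => /(_ isT) uM; exists (M + 1)%R => n.
by rewrite -(fineK (uf n)) lee_fin (le_trans (ler_norm _))//; exact: uM.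
Qed.

Lemma seq_norm_bounded (s : c0) : exists M : R, forall k, N s k <= M%:E.
Proof.
have [_ p n] := c0P s.
have [M pM] := cvg0_ubound (fun n => seq_norm_fin_num s n%:Z) p.
have [L nL] := cvg0_ubound (fun n => seq_norm_fin_num s (- n%:Z)) n.
exists (Num.max M L) => -[k|k].
  by rewrite (le_trans (pM k))// lee_fin le_max lexx.
by rewrite NegzE (le_trans (nL k.+1))// lee_fin le_max lexx orbT.
Qed.

Lemma c0_normE (s : c0) :
  (c0_norm s)%:E = ereal_sup [set N s k | k in [set: int]].
Proof.
have [M sM] := seq_norm_bounded s; rewrite /c0_norm fineK// fin_numElt.
apply/andP; split.
  by rewrite (@lt_le_trans _ _ (N s 0))//;
    [rewrite (lt_le_trans _ (seq_norm_ge0 _ _))|apply: ereal_sup_ubound; exists 0%Z].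
by rewrite (@le_lt_trans _ _ M%:E) ?ltry//; apply: ge_ereal_sup => _ [k _ <-].
Qed.

Lemma seq_norm_le_c0_norm (s : c0) k : N s k <= (c0_norm s)%:E.
Proof. by rewrite c0_normE; apply: ereal_sup_ubound; exists k. Qed.

Lemma c0_norm_le (s : c0) (M : R) :
  (forall k, N s k <= M%:E) -> (c0_norm s <= M)%R.
Proof.
by move=> sM; rewrite -lee_fin c0_normE; apply: ge_ereal_sup => _ [k _ <-].
Qed.

Lemma c0_norm_ge0 (s : c0) : (0 <= c0_norm s)%R.
Proof.
by rewrite -lee_fin (le_trans (seq_norm_ge0 s 0))// seq_norm_le_c0_norm.
Qed.

Local Definition c0_normC (s : c0) : R[i] := (c0_norm s)%:C%C.

Lemma c0_normD (s t : c0) : (c0_normC (s + t) <= c0_normC s + c0_normC t)%R.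
Proof.
rewrite /c0_normC -rmorphD lecR; apply: c0_norm_le => k.
rewrite EFinD; apply: le_trans (leeD (seq_norm_le_c0_norm s k) (seq_norm_le_c0_norm t k)).
exact (segal_normD (tau \o homeo_iter alpha k) (s k) (t k)).
Qed.

Lemma c0_normZ_le c (s : c0) : (c0_norm (c *: s) <= modulus c * c0_norm s)%R.
Proof.
apply: c0_norm_le => k; rewrite EFinM.
apply: (@le_trans _ _ ((modulus c)%:E * N s k)).
  exact (segal_normZ (tau \o homeo_iter alpha k) (s k) c).
by apply: lee_wpmul2l; rewrite ?lee_fin ?modulus_ge0// seq_norm_le_c0_norm.
Qed.

Lemma c0_normZ c (s : c0) : c0_normC (c *: s) = (`|c| * c0_normC s)%R.
Proof.
rewrite /c0_normC modulusE -rmorphM; congr (_%:C)%C; apply/eqP.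
rewrite eq_le c0_normZ_le/=; have [->|c0] := eqVneq c 0%R.
  by rewrite ComplexField.Normc.normc0 mul0r c0_norm_ge0.
have m0 : (0 < modulus c)%R.
  rewrite lt_neqAle modulus_ge0 andbT eq_sym.
  by apply: contra c0 => /eqP/ComplexField.Normc.eq0_normc ->.
rewrite -ler_pdivlMl// -ComplexField.Normc.normcV.
by rewrite -{1}[s](scalerK c0) c0_normZ_le.
Qed.

Lemma c0_norm_eq0 (s : c0) : c0_normC s = 0%R -> s = 0%R.
Proof.
move=> /(congr1 (@complex.Re R)) /= s0.
apply: val_inj => /=; apply/funext => k; apply/funext => x.
apply: ComplexField.Normc.eq0_normc; apply/eqP.
rewrite eq_le modulus_ge0 andbT -lee_fin -s0.
apply: le_trans (seq_norm_le_c0_norm s k).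
apply: le_trans (supnorm_le_segal_norm _ _); exact: supnorm_ub.
Qed.

HB.instance Definition _ :=
  Lmodule_isNormed.Build R[i] c0 c0_normD c0_normZ c0_norm_eq0.

Lemma c0_normrE (s : c0) : `|s|%R = (c0_norm s)%:C%C.
Proof. by []. Qed.

End c0_theory.

Section weighted_shift.
Variables (R : realType) (tau : R -> R[i]) (alpha : homeo R).
Variable w : int -> R -> R[i].
Hypothesis w_Cb : forall j, Cb (w j).
Hypothesis w_bounded :
  (ereal_sup [set supnorm (w j) | j in [set: int]] < +oo)%E.
Local Notation c0 := (c0 tau alpha).
Local Notation N := (seq_norm tau alpha).

Definition weighted_shift_fun (s : int -> R -> R[i]) : int -> R -> R[i] :=
  fun j x => w j x * s (j - 1) (alpha x).

Local Definition w_sup : R :=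
  fine (ereal_sup [set supnorm (w j) | j in [set: int]]).

Lemma w_sup_ub j x : modulus (w j x) <= w_sup.
Proof.
have le j' y : ((modulus (w j' y))%:E <=
    ereal_sup [set supnorm (w j) | j in [set: int]])%E.
  by apply: le_trans (supnorm_ub _ y) _; apply: ereal_sup_ubound; exists j'.
rewrite -lee_fin /w_sup fineK// ge0_fin_numE//.
by apply: le_trans (le 0 0); rewrite lee_fin modulus_ge0.
Qed.

Lemma homeo_iter_pred (j : int) :
  homeo_iter alpha j = homeo_iter alpha (j - 1) \o alpha.
Proof.
apply/funext => x; case: j => [[|n]|n].
- by rewrite sub0r /= homeoK.
- have -> : n.+1%:Z - 1 = n%:Z by rewrite intS addrAC subrr add0r.
  exact: iterSr.
- have -> : Negz n - 1 = Negz n.+1 by rewrite !NegzE [in RHS]intS opprD addrC.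
  by rewrite /homeo_iter /comp [RHS]iterSr homeoK.
Qed.

Lemma seq_norm_weighted_shift s j :
  (N (weighted_shift_fun s) j <= w_sup%:E * N s (j - 1))%E.
Proof.
rewrite /seq_norm homeo_iter_pred compA.
exact/segal_norm_weight/w_sup_ub.
Qed.

Lemma weighted_shift_subproof (s : c0) :
  weighted_shift_fun s \in c0_pred tau alpha.
Proof.
have [sA sp sn] := c0P s.
have Z (u : nat -> int) : (fun n => N s (u n - 1)) @ \oo --> 0%E ->
    (fun n => N (weighted_shift_fun s) (u n)) @ \oo --> 0%E.
  move=> su; apply: (@squeeze0 _ _ (fun n => w_sup%:E * N s (u n - 1))%E).
    by move=> n; rewrite seq_norm_ge0 seq_norm_weighted_shift.
  exact: cvge0Zl.
rewrite inE; split.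
- move=> k; rewrite homeo_iter_pred compA.
  apply: (@segal_weight _ _ _ (w k) alpha (homeo_inv alpha) w_sup) => //.
  + by have [] := w_Cb k.
  + exact: homeo_continuous.
  + exact: homeo_inv_continuous.
  + exact: homeoK.
  + exact: w_sup_ub.
- apply: (Z (fun n => n%:Z)); rewrite -(cvg_shiftS (fun n => N s (n%:Z - 1))).
  rewrite (_ : (fun n => _) = (fun n => N s n%:Z)); first exact sp.
  by apply/funext => n /=; rewrite intS addrAC subrr add0r.
- rewrite -(cvg_shiftS (fun n => N s (- n%:Z))) in sn.
  apply: (Z (fun n => - n%:Z)).
  rewrite (_ : (fun n => _) = (fun n => N s (- n.+1%:Z))); first exact sn.
  by apply/funext => n /=; rewrite intS opprD addrC.
Qed.

Definition weighted_shift (s : c0) : c0 := MkC0 (weighted_shift_subproof s).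

Lemma weighted_shift_is_linear : linear weighted_shift.
Proof.
move=> c s t; apply: val_inj; apply/funext => j; apply/funext => x /=.
by rewrite /weighted_shift_fun mulrDr; congr +%R; exact: mulrCA.
Qed.

HB.instance Definition _ :=
  GRing.isLinear.Build R[i] c0 c0 _ weighted_shift weighted_shift_is_linear.

Lemma weighted_shift_norm_le (s : c0) :
  `|weighted_shift s| <= w_sup%:C%C * `|s|.
Proof.
rewrite !c0_normrE -rmorphM lecR; apply: c0_norm_le => k.
apply: le_trans (seq_norm_weighted_shift s k) _; rewrite EFinM.
apply: lee_wpmul2l; last exact: seq_norm_le_c0_norm.
by rewrite lee_fin (le_trans (modulus_ge0 (w 0 0)))// w_sup_ub.
Qed.

Lemma weighted_shift_continuous : continuous weighted_shift.
Proof.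
apply/linear_bounded_continuous/bounded_funP => r; exists (w_sup%:C%C * r) => s sr.
apply: le_trans (weighted_shift_norm_le s) _; apply: ler_wpM2l => //.
by rewrite lecR (le_trans (modulus_ge0 (w 0 0)))// w_sup_ub.
Qed.

End weighted_shift.
Arguments weighted_shift {R} tau alpha w w_Cb w_bounded s.

(* Main.v *)
(* Put T for the shift and S for its formal inverse. On an entry supported at
   index j, T^r and S^r act, up to the change of variable alpha^{-r} or
   alpha^r, as multiplication by the two products of the statement; they move
   the index by r in opposite directions.
   If x is hypercyclic, choose v with v_j = 1 on K_j for |j| <= J and v_j = 0
   otherwise, and two orbit points s and T^r s close to v with r > 2J. Since
   v_{j+r} = v_{j-r} = 0, both products are small on K_j.
   Conversely, finitely supported sequences whose entries are compactly supported
   in sets where |tau o alpha^j| stays below some e < 1 are dense (soft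
   thresholding) and are preserved by S. If (y_k) is dense and v_k is such an
   approximation of y_k, then x = sum_k S^{r_k} v_k is hypercyclic for r_k growing
   fast enough. S^{r_k} v_k lives at indices < -k, so every entry of x is a finite
   sum and no completeness is needed. *)

Require Import Defs.
From HB Require Import structures.
From mathcomp Require Import all_boot all_order all_algebra complex.
From mathcomp Require Import all_classical all_reals all_analysis.
From mathcomp Require Import zify ring lra.

Import Order.TTheory GRing.Theory Num.Theory.
Import numFieldNormedType.Exports.

Local Open Scope classical_set_scope.
Local Open Scope ring_scope.
Local Open Scope complex_scope.

Set Implicit Arguments.
Unset Strict Implicit.

(** * Modulus, continuity and comparison of Segal norms *)

Lemma modulusX (R : realType) (z : R[i]) n : modulus (z ^+ n) = modulus z ^+ n.
Proof.
elim: n => [|n IH]; first by rewrite !expr0 ComplexField.Normc.normc1.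
by rewrite !exprS ComplexField.Normc.normcM IH.
Qed.

Lemma modulus_real (R : realType) (x : R) : modulus x%:C = `|x|.
Proof. by rewrite /= expr0n /= addr0 sqrtr_sqr. Qed.

Lemma modulusN (R : realType) (z : R[i]) : modulus (- z) = modulus z.
Proof. by apply: complexI; rewrite -!modulusE normrN. Qed.

Lemma modulus_gt0 (R : realType) (z : R[i]) : (0 < modulus z) = (z != 0).
Proof. by rewrite -ltcR -modulusE normr_gt0. Qed.

Lemma ler_dist_modulus (R : realType) (z w : R[i]) :
  `|modulus z - modulus w| <= modulus (z - w).
Proof.
rewrite ler_norml; apply/andP; split.
  rewrite lerBrDr addrC lerBlDr -(modulusN (z - w)) opprB.
  by rewrite (le_trans _ (modulusD _ _))// addrC subrK.
by rewrite lerBlDr (le_trans _ (modulusD _ _))// subrK.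
Qed.

Lemma continuous_modulus (R : realType) (f : R -> R[i]) :
  continuous f -> continuous (fun x => modulus (f x)).
Proof.
move=> cf x; apply/cvgrPdist_lt => e e0.
have eC : 0 < e%:C by rewrite ltcR.
have /cvgrPdist_lt/(_ _ eC) := cf x; apply: filterS => y.
by rewrite modulusE ltcR => /(le_lt_trans _); apply; exact: ler_dist_modulus.
Qed.

Lemma continuous_realC (R : realType) (f : R -> R) :
  continuous f -> continuous (fun x => (f x)%:C : R[i]).
Proof.
move=> cf x; apply/cvgrPdist_lt => /= e e0.
have eE : e = (complex.Re e)%:C by apply/esym/RRe_real/gtr0_real.
have e'0 : 0 < complex.Re e by rewrite -ltcR -eE.
have /cvgrPdist_lt/(_ _ e'0) := cf x; apply: filterS => y.
by rewrite -rmorphB modulusE modulus_real eE ltcR.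
Qed.

Lemma continuous_clamp (R : realType) (f : R -> R) :
  continuous f -> continuous (fun x => Num.min 1 (Num.max 0 (f x))).
Proof.
move=> cf x.
have c0 (c : R) : {for x, continuous (cst c : R -> R^o)} by exact: cvg_cst.
exact (continuous_min (c0 1) (continuous_max (c0 0) (cf x))).
Qed.

(** Domination passes to every term of the series. Since [M] is compared after multiplication by
    [f], a weight has to be bounded by [M] only where [f] is nonzero. *)
Lemma segal_norm_comp_le (R : realType) (rho f g : R -> R[i]) (a : R -> R) M :
  0 <= M -> (forall x, modulus (g x) <= M * modulus (f (a x))) ->
  (segal_norm (rho \o a) g <= M%:E * segal_norm rho f)%E.
Proof.
move=> M0 gM; rewrite /segal_norm -nneseriesZl; last by move=> *; exact: supnorm_ge0.
apply: lee_nneseries => [*|n _]; first exact: supnorm_ge0.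
apply: supnorm_le => x /=; rewrite ComplexField.Normc.normcM.
apply: (@le_trans _ _ (M * modulus (f (a x) * rho (a x) ^+ n))%:E).
  rewrite lee_fin ComplexField.Normc.normcM mulrA ler_wpM2r ?modulus_ge0//.
rewrite EFinM; apply: lee_wpmul2l; first by rewrite lee_fin.
exact: (supnorm_ub (fun y => f y * rho y ^+ n)).
Qed.

Lemma segal_norm_eq (R : realType) (rho f g : R -> R[i]) :
  f =1 g -> segal_norm rho f = segal_norm rho g.
Proof. by move=> /funext ->. Qed.

(** * Compactly supported functions in a Segal algebra *)

Section compact_support.
Context {R : realType}.
Implicit Types (f g rho : R -> R[i]).

(** Such [K] and [e] are exactly those over which the criterion quantifies. [K] may be larger than
    the support, so that several functions can share it. *)
Definition Csupp_in rho f (K : set R) (e : R) :=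
  [/\ 0 < e < 1, compact K, K `<=` (fun t => modulus (rho t)) @^-1` `[0, e]
    & forall x, ~ K x -> f x = 0].

Definition Csupp rho f :=
  continuous f /\ exists K e, Csupp_in rho f K e.

(** On [K] the k-th term is at most [M * e ^+ k] and elsewhere [f] is zero, so a geometric series
    dominates. *)
Lemma segal_norm_Csupp_le rho f K e M :
  Csupp_in rho f K e -> 0 <= M -> (forall x, modulus (f x) <= M) ->
  (segal_norm rho f <= (M / (1 - e))%:E)%E.
Proof.
move=> [/andP[e0 e1] _ Ke fK] M0 fM; apply: lime_le.
  by apply: is_cvg_nneseries => *; exact: supnorm_ge0.
apply: nearW => n.
apply: (@le_trans _ _ (series (geometric M e) n)%:E); last first.
  by rewrite lee_fin geometric_le_lim// gtr0_norm.
rewrite /series /= -sumEFin; apply: lee_sum => k _; apply: supnorm_le => x.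
rewrite lee_fin ComplexField.Normc.normcM modulusX /geometric /=.
have [/Ke/=|/fK ->] := pselect (K x); last first.
  by rewrite ComplexField.Normc.normc0 mul0r mulr_ge0// exprn_ge0// ltW.
rewrite in_itv/= => /andP[_ re].
by rewrite ler_pM ?modulus_ge0 ?exprn_ge0 ?modulus_ge0// lerXn2r ?nnegrE ?modulus_ge0// ltW.
Qed.

Lemma Csupp_C0 rho f : Csupp rho f -> C0 f.
Proof.
move=> [cf [K [e [_ cK _ fK]]]]; split=> // d d0; exists K => // x /fK ->.
by rewrite ComplexField.Normc.normc0.
Qed.

Lemma C0_bounded f : C0 f -> exists2 M, 0 <= M & forall x, modulus (f x) <= M.
Proof.
move=> [cf f0]; have [K cK fK] := f0 _ ltr01.
have [K0|nK] := pselect (K !=set0).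
  have [c _ cmax] := compact_EVT_max K0 cK
    (continuous_subspaceT (continuous_modulus cf)).
  exists (Num.max 1 (modulus (f c))) => [|y]; first by rewrite le_max ler01.
  rewrite le_max; have [Ky|/fK/ltW ->//] := pselect (K y).
  by rewrite cmax ?orbT// inE.
by exists 1 => // y; apply/ltW/fK => Ky; apply: nK; exists y.
Qed.

Lemma Csupp_segal rho f : Csupp rho f -> segal rho f.
Proof.
move=> fC; have f0 := Csupp_C0 fC; split=> //.
have [M M0 fM] := C0_bounded f0; have [cf [K [e fK]]] := fC.
exact: le_lt_trans (segal_norm_Csupp_le fK M0 fM) (ltry _).
Qed.

(** Where |rho x| >= 1 every term of the series is at least |f x|, so a nonzero value would make the
    partial sums grow linearly. *)
Lemma segal_vanishes rho f x : segal rho f -> 1 <= modulus (rho x) -> f x = 0.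
Proof.
move=> [_ fr] r1; apply: contrapT => /eqP fx0.
have fx : 0 < modulus (f x) by rewrite modulus_gt0.
have h n : ((n%:R * modulus (f x))%:E <= segal_norm rho f)%E.
  apply: le_trans (nneseries_lim_ge n (P := xpredT) _); last by move=> *; exact: supnorm_ge0.
  rewrite mulr_natl -[X in _ *+ X]subn0 -sumr_const_nat -sumEFin; apply: lee_sum => k _.
  apply: le_trans (supnorm_ub _ x); rewrite lee_fin ComplexField.Normc.normcM modulusX.
  by rewrite ler_peMr ?modulus_ge0// exprn_ege1.
have fin : segal_norm rho f \is a fin_num by rewrite ge0_fin_numE// segal_norm_ge0.
move: h; rewrite -(fineK fin) => h.
have {h} h n : n%:R <= fine (segal_norm rho f) / modulus (f x).
  by have := h n; rewrite lee_fin -ler_pdivlMr.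
have := h (Num.truncn (fine (segal_norm rho f) / modulus (f x))).+1.
by rewrite leNgt truncnS_gt.
Qed.

Lemma Csupp_inUl rho f K L e d : 0 < d < 1 -> compact L ->
  L `<=` (fun t => modulus (rho t)) @^-1` `[0, d] ->
  Csupp_in rho f K e -> Csupp_in rho f (K `|` L) (Num.max e d).
Proof.
move=> /andP[d0 d1] cL Ld [/andP[e0 e1] cK Ke fK]; split.
- by rewrite lt_max e0 gt_max e1 d1.
- exact: compactU.
- by move=> t [/Ke|/Ld] /=; rewrite !in_itv/= => /andP[-> h];
    rewrite le_max h ?orbT.
- by move=> x /not_orP[/fK].
Qed.

Lemma Csupp_inUr rho f K L e d : 0 < d < 1 -> compact L ->
  L `<=` (fun t => modulus (rho t)) @^-1` `[0, d] ->
  Csupp_in rho f K e -> Csupp_in rho f (L `|` K) (Num.max d e).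
Proof. by rewrite setUC maxC; exact: Csupp_inUl. Qed.

Lemma CsuppD rho f g :
  Csupp rho f -> Csupp rho g -> Csupp rho (fun x => f x + g x).
Proof.
move=> [cf [K [e fK]]] [cg [L [d gL]]]; split.
  by move=> x; exact: cvgD (cf x) (cg x).
exists (K `|` L), (Num.max e d).
have [e01 cK Ke _] := fK; have [d01 cL Ld _] := gL.
have [? ? ? fU] := Csupp_inUl d01 cL Ld fK.
have [_ _ _ gU] := Csupp_inUr e01 cK Ke gL.
by split=> // x nx; rewrite fU// gU// addr0.
Qed.

Lemma Csupp0 rho : Csupp rho (fun=> 0).
Proof.
split; first by move=> x; exact: cvg_cst.
by exists set0, 2^-1; split => //; rewrite ?invr_gt0 ?invf_lt1 ?ltr1n ?ltr0n//; exact: compact0.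
Qed.

Lemma Csupp_comp rho f (c : R -> R[i]) (a b : R -> R) :
  continuous c -> continuous a -> continuous b -> cancel a b -> cancel b a ->
  Csupp rho f -> Csupp (rho \o a) (fun x => c x * f (a x)).
Proof.
move=> cc ca cb abK baK [cf [K [e [e01 cK Ke fK]]]]; split.
  move=> x; apply: (@cvgM R[i] R _ _ c (f \o a)); first exact: cc.
  exact: continuous_comp (ca x) (cf (a x)).
exists (b @` K), e; split=> //.
- by apply: continuous_compact => //; exact: continuous_subspaceT.
- by move=> _ [t Kt <-] /=; rewrite baK; exact: Ke.
- by move=> x nx; rewrite fK ?mulr0// => Kax; apply: nx; exists (a x).
Qed.

(** A product of two continuous cutoffs: the one in |x| makes the support compact, the one in |rho
    x| falls from 1 at level [e] to 0 at level [d], which keeps |rho| <= d < 1 on the support. *)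
Lemma Csupp_bump rho K e : continuous rho -> 0 < e < 1 -> compact K ->
  K `<=` (fun t => modulus (rho t)) @^-1` `[0, e] ->
  exists2 f, Csupp rho f & forall x, K x -> f x = 1.
Proof.
move=> crho /andP[e0 e1] cK Ke; have [M [_ /(_ (`|M| + 1))]] := compact_bounded cK.
rewrite (le_lt_trans (ler_norm M)) ?ltrDl// => /(_ isT) KM.
(* The midpoint of [e] and 1 leaves room for the transition and stays below 1. *)
pose d := (1 + e) / 2; pose clamp (y : R) : R := Num.min 1 (Num.max 0 y).
have ed : e < d by rewrite /d; lra.
pose f x : R[i] := (clamp (`|M| + 2 - `|x|))%:C *
  (clamp ((d - modulus (rho x)) / (d - e)))%:C.
have clamp0 y : y <= 0 -> clamp y = 0 by move=> y0; rewrite /clamp (max_idPl y0) (min_idPr ler01).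
have clamp1 y : 1 <= y -> clamp y = 1.
  by move=> y1; rewrite /clamp (max_idPr (le_trans ler01 y1)) (min_idPl y1).
exists f; last first.
  move=> x Kx; have /= := Ke x Kx; rewrite in_itv/= => /andP[_ re].
  rewrite /f !clamp1 ?mulr1//.
  - by rewrite ler_pdivlMr ?subr_gt0// mul1r lerB.
  - by have := KM x Kx; rewrite /=; lra.
split.
  move=> x; apply: (@cvgM R[i] R); move: x; apply: continuous_realC; apply: continuous_clamp.
    by move=> x; apply: cvgB; [exact: cvg_cst|exact: norm_continuous].
  move=> x; apply: cvgM; last exact: cvg_cst.
  by apply: cvgB; [exact: cvg_cst|exact: continuous_modulus].
exists (`[- (`|M| + 2), `|M| + 2]%classic `&` (fun t => modulus (rho t)) @^-1` `[0, d]%classic), d; split.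
- by rewrite (lt_trans e0 ed)/= /d; lra.
- apply: (subclosed_compact _ (@segment_compact _ _ _)) => //.
  apply: closedI; first exact: interval_closed.
  by apply: (proj1 (continuous_closedP _) (continuous_modulus crho)); exact: interval_closed.
- by move=> t [].
- move=> x; rewrite /f => /not_andP[] /=.
    rewrite in_itv/= -ler_norml => /negP; rewrite -ltNge => xM.
    by rewrite clamp0 ?mul0r// subr_le0 ltW.
  rewrite in_itv/= modulus_ge0/= => /negP; rewrite -ltNge => xM.
  by rewrite [X in _ * X%:C]clamp0 ?mulr0// pmulr_lle0 ?invr_gt0 ?subr_gt0// subr_le0 ltW.
Qed.

(* Soft thresholding: [f] vanishes where [|rho| >= 1], so [|rho|] is bounded away from 1 on the compact set [{|f| >= eta}]. *)
Lemma segal_approx rho f d : continuous rho -> segal rho f -> 0 < d ->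
  exists2 g, Csupp rho g & (segal_norm rho (fun x => f x - g x)%R <= d%:E)%E.
Proof.
move=> crho fS d0; have [f0 fr] := fS; have [cf f00] := f0.
have d20 : 0 < d / 2 by rewrite divr_gt0.
have [N tailN] : exists N,
    (\sum_(N <= k <oo) supnorm (fun x => f x * rho x ^+ k)%R <= (d / 2)%:E)%E.
  have := nneseries_tail_cvg fr (fun k _ => supnorm_ge0 _).
  move=> /fine_cvgP[[N1 _ fin1]] /cvgrPdist_le/(_ _ d20)[N2 _ h].
  exists (maxn N1 N2).
  have := h (maxn N1 N2) (leq_maxr _ _); rewrite /= sub0r normrN => h'.
  rewrite -[leLHS](fineK (fin1 _ (leq_maxl _ _))) lee_fin.
  exact: le_trans (ler_norm _) h'.
(* The first [N] terms will each be at most [2 * eta], hence at most [d / 2] in total; the successor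
   keeps the denominator nonzero. *)
pose eta := d / 4 / N.+1%:R.
have eta0 : 0 < eta by rewrite !divr_gt0.
(* [h] is 0 where |f| <= eta and 1 where |f| >= 2 * eta, so |f - g| <= 2 * eta everywhere. *)
pose h x : R := Num.min 1 (Num.max 0 (modulus (f x) / eta - 1)).
have h01 x : 0 <= h x <= 1 by rewrite /h le_min ler01 le_max lexx/= ge_min lexx.
pose g x : R[i] := f x * (h x)%:C.
have h1 x : modulus (1 - (h x)%:C) <= 1.
  have /andP[h0 h1] := h01 x; rewrite -[1](rmorph1 (real_complex R)) -rmorphB modulus_real.
  by rewrite ger0_norm ?subr_ge0// gerBl.
have fg x : f x - g x = f x * (1 - (h x)%:C) by rewrite mulrBr mulr1.
have fg1 x : modulus (f x - g x) <= modulus (f x).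
  by rewrite fg ComplexField.Normc.normcM ler_piMr ?modulus_ge0.
have fg2 x : modulus (f x - g x) <= 2 * eta.
  have [fe|/ltW fe] := leP (modulus (f x)) (2 * eta); first exact: le_trans (fg1 x) fe.
  rewrite fg (_ : h x = 1) ?subrr ?mulr0 ?ComplexField.Normc.normc0 ?mulr_ge0 ?ltW//.
  apply/min_idPl; rewrite le_max; apply/orP; right.
  by rewrite lerBrDr ler_pdivlMr// (_ : 1 + 1 = 2).
exists g; last first.
  rewrite /segal_norm (nneseries_split 0 N); last by move=> *; exact: supnorm_ge0.
  rewrite add0n [d]splitr EFinD; apply: leeD; last first.
    apply: le_trans tailN; apply: lee_nneseries => [*|k _]; first exact: supnorm_ge0.
    apply: supnorm_le => x; apply: le_trans (supnorm_ub _ x).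
    by rewrite lee_fin !ComplexField.Normc.normcM ler_wpM2r ?modulus_ge0.
  apply: (@le_trans _ _ (\sum_(0 <= k < N) (2 * eta)%:E)%E).
    apply: lee_sum => k _; apply: supnorm_le => x; rewrite lee_fin.
    rewrite ComplexField.Normc.normcM modulusX.
    (* The powers of |rho| may be large where |rho| >= 1, but [f], hence [f - g], is zero there;
       elsewhere they are at most 1. *)
    have [r1|r1] := leP 1 (modulus (rho x)).
      rewrite (segal_vanishes fS r1) in fg1 *; have := fg1 x.
      rewrite (segal_vanishes fS r1) ComplexField.Normc.normc0 sub0r => g0.
      have -> : modulus (- g x) = 0 by apply/eqP; rewrite eq_le g0 modulus_ge0.
      by rewrite mul0r mulr_ge0// ltW.
    rewrite -[leRHS]mulr1 ler_pM ?modulus_ge0 ?exprn_ge0 ?modulus_ge0//.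
    by rewrite exprn_ile1 ?modulus_ge0// ltW.
  rewrite sumEFin lee_fin sumr_const_nat subn0 -[leLHS]mulr_natr /eta.
  rewrite [leLHS](_ : _ = (d / 2) * (N%:R / N.+1%:R)); last first.
    have : N.+1%:R != 0 :> R by rewrite pnatr_eq0.
    by move=> ?; field.
  apply: ler_piMr; first exact: ltW.
  by rewrite ler_pdivrMr// mul1r ler_nat.
split.
  move=> x; apply: (@cvgM R[i] R); first exact: cf.
  move: x; apply: continuous_realC; apply: continuous_clamp => x.
  apply: cvgB; last exact: cvg_cst.
  by apply: cvgM; [exact: continuous_modulus|exact: cvg_cst].
pose K := (fun x => modulus (f x)) @^-1` [set y | eta <= y].
have cK : compact K.
  have [L cL fL] := f00 _ eta0; apply: subclosed_compact cL _.
    apply: (proj1 (continuous_closedP _) (continuous_modulus cf)).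
    exact: closed_ge.
  by move=> x Kx; apply: contrapT => /fL; rewrite ltNge => /negP; apply.
have [e e01 Ke] : exists2 e : R, 0 < e < 1 & forall x, K x -> modulus (rho x) <= e.
  have [K0|nK] := pselect (K !=set0); last first.
    by exists 2^-1 => [|x Kx]; [rewrite invr_gt0 invf_lt1 ?ltr1n ?ltr0n|exfalso; apply: nK; exists x].
  have [c Kc cmax] := compact_EVT_max K0 cK
    (continuous_subspaceT (continuous_modulus crho)).
  (* The maximum with 1/2 keeps the bound positive even if [rho] vanishes on [K]. *)
  exists (Num.max 2^-1 (modulus (rho c))) => [|x Kx]; last first.
    by rewrite le_max cmax ?orbT// inE.
  rewrite lt_max invr_gt0 ltr0n/= gt_max invf_lt1 ?ltr1n ?ltr0n//= ltNge.
  apply/negP => /(segal_vanishes fS) fc; move: Kc; rewrite inE /K /= fc.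
  by rewrite ComplexField.Normc.normc0 leNgt eta0.
exists K, e; split=> //.
  by move=> x /Ke /=; rewrite in_itv/= modulus_ge0.
move=> x /negP; rewrite -ltNge => fx; rewrite /g (_ : h x = 0) ?mulr0//.
rewrite /h (max_idPl _) ?(min_idPr ler01)//.
by rewrite subr_le0 ler_pdivrMr// mul1r ltW.
Qed.

End compact_support.

Lemma cvge0P (R : realType) (u : nat -> \bar R) : (forall n, 0 <= u n)%E ->
  u @ \oo --> 0%E <->
  forall e : R, 0 < e -> exists N, forall n, (N <= n)%N -> (u n <= e%:E)%E.
Proof.
move=> u0; split=> [/fine_cvgP[[N1 _ fin]] /cvgr0_norm_le uc e /uc[N2 _ h]|h].
  exists (maxn N1 N2) => n; rewrite geq_max => /andP[/fin/= n1 /h/= n2].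
  by rewrite -(fineK n1) lee_fin (le_trans (ler_norm _)).
have fin e N : (forall n, (N <= n)%N -> (u n <= e%:E)%E) ->
    forall n, (N <= n)%N -> u n \is a fin_num.
  by move=> hN n /hN ue; rewrite ge0_fin_numE// (le_lt_trans ue) ?ltry.
apply/fine_cvgP; split.
  by have [N /fin {}h] := h _ ltr01; exists N.
apply/cvgr0Pnorm_le => e /h[N hN]; exists N => // n /= Nn.
by rewrite ger0_norm ?fine_ge0// -lee_fin fineK ?hN// (fin _ _ hN).
Qed.

(** * Integer iterates of the homeomorphism *)

Section homeo_iterates.
Context {R : realType} (alpha : homeo R).
Local Notation h := (homeo_iter alpha).
Local Notation inv := (homeo_inv alpha).

Lemma homeo_iterN n : h (- n%:Z) = iter n inv.
Proof. by case: n. Qed.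

Lemma homeo_iterS j : h (j + 1) = h j \o alpha.
Proof. by rewrite homeo_iter_pred addrK. Qed.

Lemma homeo_iter_inv j : h (j + 1) \o inv = h j.
Proof. by apply/funext => x; rewrite homeo_iterS /= homeo_invK. Qed.

Lemma homeo_iterD j (n : nat) x : h (j + n%:Z) x = h j (h n%:Z x).
Proof.
elim: n x => [|n IH] x; first by rewrite addr0.
rewrite {1}intS addrCA addrC homeo_iterS /= IH.
by congr (h j _); rewrite -[LHS]/(iter n alpha (alpha x)) -iterSr.
Qed.

Lemma iter_cancel (T : Type) (f g : T -> T) n : cancel f g -> cancel (iter n f) (iter n g).
Proof. by move=> fK; elim: n => // n IH x; rewrite iterSr iterS fK. Qed.

Lemma homeo_iterK n : cancel (h n%:Z) (h (- n%:Z)).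
Proof. by rewrite homeo_iterN; exact/iter_cancel/homeoK. Qed.

Lemma homeo_iterNK n : cancel (h (- n%:Z)) (h n%:Z).
Proof. by rewrite homeo_iterN; exact/iter_cancel/homeo_invK. Qed.

Lemma homeo_iterNS (n : nat) x : h (- n%:Z) x = alpha (h (- n.+1%:Z) x).
Proof. by rewrite !homeo_iterN iterS homeo_invK. Qed.

Lemma iter_continuous (f : R -> R) n : continuous f -> continuous (iter n f).
Proof.
move=> cf; elim: n => [x|n IH x]; first exact: cvg_id.
exact: continuous_comp (IH x) (cf _).
Qed.

Lemma homeo_iter_continuous j : continuous (h j).
Proof.
by case: j => n; apply: iter_continuous;
  [exact: homeo_continuous|exact: homeo_inv_continuous].
Qed.

End homeo_iterates.

(** * Iterates of the shift and of its formal inverse *)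

Section iterates.
Context {R : realType} (alpha : homeo R) (w : int -> R -> R[i]).
Hypothesis w_neq0 : forall j x, w j x != 0.
Implicit Types s : int -> R -> R[i].
Local Notation h := (homeo_iter alpha).
Local Notation T := (weighted_shift_fun alpha w).

Definition forward_prod j r t : R[i] :=
  \prod_(1 <= i < r.+1) (w (i%:Z + j) \o h (- i%:Z)) t.

Definition backward_prod j r t : R[i] :=
  \prod_(1 <= i < r.+1) ((w (j + 1 - i%:Z) \o h (i%:Z - 1)) t)^-1.

(** Defined on arbitrary sequences of functions, so that the inversion identities hold before
    membership in [c0] is known. *)
Definition unshift s : int -> R -> R[i] :=
  fun j x => (w (j + 1) (homeo_inv alpha x))^-1 * s (j + 1) (homeo_inv alpha x).

Lemma shift_unshift s : T (unshift s) = s.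
Proof.
apply/funext => j; apply/funext => x; rewrite /weighted_shift_fun /unshift.
by rewrite subrK homeoK mulVKf.
Qed.

Lemma unshift_shift s : unshift (T s) = s.
Proof.
apply/funext => j; apply/funext => x; rewrite /weighted_shift_fun /unshift.
by rewrite addrK homeo_invK mulKf.
Qed.

Lemma iter_shift_unshift r s : iter r T (iter r unshift s) = s.
Proof. by apply: iter_cancel => {}s; exact: shift_unshift. Qed.

(** Following the entry [j] to index [j + r] and point alpha^{-r} t makes step [i] contribute the
    factor w_{i+j}(alpha^{-i} t), which does not depend on [r]; induction then adds one factor at a
    time. *)
Lemma iter_shiftE s r j t :
  iter r T s (j + r%:Z) (h (- r%:Z) t) = forward_prod j r t * s j t.
Proof.
rewrite /forward_prod; elim: r => [|r IH].
  by rewrite big_geq// mul1r oppr0 addr0.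
rewrite iterS {1}/weighted_shift_fun -homeo_iterNS.
rewrite (_ : j + r.+1%:Z - 1 = j + r%:Z); last by rewrite -addrA intS addrAC subrr add0r.
by rewrite IH [in RHS]big_nat_recr// mulrA (addrC j) [in LHS](mulrC (w _ _)).
Qed.

Lemma iter_unshiftE s r j t :
  iter r unshift s (j - r%:Z) (h r%:Z t) = backward_prod j r t * s j t.
Proof.
rewrite /backward_prod; elim: r => [|r IH].
  by rewrite big_geq// mul1r subr0.
rewrite iterS {1}/unshift /= homeoK.
(* The new factor is w_{j-r} at alpha^r t, the one with [i = r + 1] in the product. *)
rewrite (_ : j - r.+1%:Z + 1 = j - r%:Z); last by rewrite -addrA intS opprD addrAC addNr add0r.
rewrite [iter r _ _ _ _]IH [in RHS]big_nat_recr// mulrA [in LHS](mulrC (w _ _)^-1).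
congr (_ * (w _ _)^-1 * _); first by rewrite intS opprD addrA addrK.
by rewrite intS addrAC subrr add0r.
Qed.

Section growth.
Variable tau : R -> R[i].
Local Notation N := (seq_norm tau alpha).

(** The norm at index [j + r] has weight tau o alpha^j o alpha^r, so the change of variable t =
    alpha^r x carries it to the norm at index [j]. *)
Lemma seq_norm_iter_shift s r j M : 0 <= M ->
  (forall t, modulus (forward_prod j r t * s j t) <= M * modulus (s j t)) ->
  (N (iter r T s) (j + r%:Z) <= M%:E * N s j)%E.
Proof.
move=> M0 sM; rewrite /seq_norm.
have -> : tau \o h (j + r%:Z) = (tau \o h j) \o h r%:Z.
  by apply/funext => x; rewrite /comp homeo_iterD.
apply: segal_norm_comp_le => // x.
by rewrite -[in leLHS](homeo_iterK alpha r x) iter_shiftE.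
Qed.

Lemma seq_norm_iter_unshift s r j M : 0 <= M ->
  (forall t, modulus (backward_prod j r t * s j t) <= M * modulus (s j t)) ->
  (N (iter r unshift s) (j - r%:Z) <= M%:E * N s j)%E.
Proof.
move=> M0 sM; rewrite /seq_norm.
have -> : tau \o h (j - r%:Z) = (tau \o h j) \o h (- r%:Z).
  by apply/funext => x; rewrite /comp -{1}(homeo_iterNK alpha r x) -homeo_iterD subrK.
apply: segal_norm_comp_le => // x.
by rewrite -[in leLHS](homeo_iterNK alpha r x) iter_unshiftE.
Qed.

End growth.
End iterates.

(** * Bounds on products and on suprema over a set *)

Lemma modulus_prod_le (R : realType) (F : nat -> R[i]) C r :
  (forall i, modulus (F i) <= C) -> modulus (\prod_(1 <= i < r.+1) F i) <= C ^+ r.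
Proof.
move=> FC; elim: r => [|r IH].
  by rewrite big_geq// ComplexField.Normc.normc1 expr0.
by rewrite big_nat_recr//= ComplexField.Normc.normcM exprSr ler_pM ?modulus_ge0.
Qed.

Lemma sup_image_bounds (R : realType) (T : Type) (f : T -> R) (K : set T) M :
  0 <= M -> (forall t, K t -> 0 <= f t <= M) ->
  0 <= sup [set f t | t in K] <= M.
Proof.
(* For empty [K] the supremum takes its default value 0, which is where [0 <= M] enters. *)
move=> M0 fM; have [[t Kt]|K0] := pselect (K !=set0); last first.
  rewrite (_ : [set f t | t in K] = set0) ?sup0 ?lexx//.
  by apply/seteqP; split=> // x [u Ku _]; exfalso; apply: K0; exists u.
have ub : ubound [set f t | t in K] M by move=> _ [u /fM/andP[_ ?] <-].
apply/andP; split; last first.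
  by apply: ge_sup => //; exists (f t), t.
have /andP[ft _] := fM t Kt; apply: le_trans ft _.
by apply: ub_le_sup; [exists M|exists t].
Qed.

Lemma le_sup_image (R : realType) (T : Type) (f : T -> R) (K : set T) M t :
  (forall t, f t <= M) -> K t -> f t <= sup [set f t | t in K].
Proof.
by move=> fM Kt; apply: ub_le_sup; [exists M => _ [u _ <-]|exists t].
Qed.

(** * Finitely supported sequences and their density *)

Section finitely_supported.
Context {R : realType} (tau : R -> R[i]) (alpha : homeo R).
Implicit Types s t : int -> R -> R[i].
Local Notation h := (homeo_iter alpha).
Local Notation N := (seq_norm tau alpha).

(** Merges the two one-sided limits into one smallness condition in the absolute value of the
    index. *)
Lemma c0_setP s : c0_set tau alpha s <->
  (forall j, segal (tau \o h j) (s j)) /\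
  forall e : R, 0 < e -> exists J, forall j, (J < `|j|)%N -> (N s j <= e%:E)%E.
Proof.
have N0 (u : nat -> int) n : (0 <= N s (u n))%E by exact: seq_norm_ge0.
split=> [[sS sp sn]|[sS sJ]].
  split=> // e e0.
  have [n1 h1] := proj1 (cvge0P (N0 (fun n => n%:Z))) sp _ e0.
  have [n2 h2] := proj1 (cvge0P (N0 (fun n => - n%:Z))) sn _ e0.
  exists (maxn n1 n2) => -[n|n]; rewrite ?NegzE ?abszN /= gtn_max => /andP[? ?].
    by apply: h1; exact: ltnW.
  by apply: h2; exact: ltnW.
split=> //.
  apply/(cvge0P (N0 (fun n => n%:Z))) => e /sJ[J hJ].
  by exists J.+1 => n Jn; apply: hJ.
apply/(cvge0P (N0 (fun n => - n%:Z))) => e /sJ[J hJ].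
by exists J.+1 => n Jn; apply: hJ; rewrite abszN.
Qed.

Definition fin_Csupp s :=
  (forall j, Csupp (tau \o h j) (s j)) /\
  exists J, forall j, (J < `|j|)%N -> s j = fun=> 0.

Lemma fin_Csupp_c0 s : fin_Csupp s -> c0_set tau alpha s.
Proof.
move=> [sC [J sJ]]; apply/c0_setP; split=> [j|e e0]; first exact: Csupp_segal.
by exists J => j /sJ sj; rewrite /seq_norm sj segal_norm0 lee_fin ltW.
Qed.

Lemma fin_CsuppD s t : fin_Csupp s -> fin_Csupp t -> fin_Csupp (s + t).
Proof.
move=> [sC [J sJ]] [tC [L tL]]; split=> [j|]; first exact: CsuppD.
exists (maxn J L) => j; rewrite gtn_max => /andP[/sJ sj /tL tj].
by apply/funext => x; rewrite /= /GRing.add /= sj tj addr0.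
Qed.

Definition c0_of s (sC : fin_Csupp s) : c0 tau alpha := MkC0 (mem_set (fin_Csupp_c0 sC)).

(** Entries of large index have norm at most [d] and are replaced by 0; each of the remaining ones
    is approximated within [d] by [segal_approx]. The norm is a supremum, so the errors do not add
    up. *)
Lemma fin_Csupp_dense (s : c0 tau alpha) (d : R) : continuous tau -> 0 < d ->
  exists2 g : c0 tau alpha, fin_Csupp g & c0_norm (s - g) <= d.
Proof.
move=> ctau d0; have /c0_setP[sS /(_ _ d0)[J sJ]] := c0P s.
have ch j : continuous (tau \o h j).
  by move=> x; apply: continuous_comp; [exact: homeo_iter_continuous|exact: ctau].
have /choice[g gP] : forall j, exists g : R -> R[i], [/\ Csupp (tau \o h j) g,
    (segal_norm (tau \o h j) (fun x => c0_seq s j x - g x)%R <= d%:E)%E &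
    (J < `|j|)%N -> g = fun=> 0].
  move=> j; have [Jj|Jj] := ltnP J `|j|; last first.
    by have [g gC gs] := segal_approx (ch j) (sS j) d0; exists g.
  exists (fun=> 0); split=> [||//]; first exact: Csupp0.
  apply: le_trans (sJ j Jj); rewrite le_eqVlt; apply/orP; left; apply/eqP.
  by apply: segal_norm_eq => x; rewrite subr0.
have gC : fin_Csupp g by split=> [j|]; [have [] := gP j|exists J => j; have [] := gP j].
exists (c0_of gC) => //; apply: c0_norm_le => j.
by have [_ + _] := gP j.
Qed.

Section unshift.
Variable w : int -> R -> R[i].
Hypothesis w_neq0 : forall j x, w j x != 0.
Hypothesis w_continuous : forall j, continuous (w j).

Lemma fin_Csupp_unshift s : fin_Csupp s -> fin_Csupp (unshift alpha w s).
Proof.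
move=> [sC [J sJ]]; split=> [j|].
  have -> : tau \o h j = (tau \o h (j + 1)) \o homeo_inv alpha.
    by rewrite -compA homeo_iter_inv.
  apply: (@Csupp_comp _ _ _ (fun x => (w (j + 1) (homeo_inv alpha x))^-1) _ alpha).
  - move=> x; apply: cvgV; first exact: w_neq0.
    exact: continuous_comp (@homeo_inv_continuous _ alpha x) (@w_continuous _ _).
  - exact: homeo_inv_continuous.
  - exact: homeo_continuous.
  - exact: homeo_invK.
  - exact: homeoK.
  - exact: sC.
(* The support moves down by one index. *)
exists J.+1 => j Jj; apply/funext => x; rewrite /unshift sJ ?mulr0//.
by lia.
Qed.

Lemma fin_Csupp_iter_unshift r s : fin_Csupp s -> fin_Csupp (iter r (unshift alpha w) s).
Proof. by move=> sC; elim: r => // r; exact: fin_Csupp_unshift. Qed.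

(** The entry of S^r s at index [j] is a multiple of the entry of [s] at [j + r], up to a change of
    variable, so the support slides down by [r]. *)
Lemma iter_unshift_eq0 r s (J : nat) : (forall j, (J < `|j|)%N -> s j = fun=> 0) ->
  forall j, J%:Z < j + r%:Z -> iter r (unshift alpha w) s j = fun=> 0.
Proof.
move=> sJ j Jj; apply/funext => x.
rewrite -[j](addrK r%:Z) -(homeo_iterNK alpha r x) iter_unshiftE sJ ?mulr0//.
by lia.
Qed.

End unshift.
End finitely_supported.

(** * From the product condition to small iterates *)

Section criterion.
Context {R : realType} (tau : R -> R[i]) (alpha : homeo R) (w : int -> R -> R[i]).
Hypothesis w_neq0 : forall j x, w j x != 0.
Hypothesis w_bounded :
  (ereal_sup [set supnorm (w j) | j in [set: int]] < +oo)%E.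
Hypothesis winv_bounded :
  (ereal_sup [set supnorm (fun x => (w j x)^-1)%R | j in [set: int]] < +oo)%E.
Local Notation h := (homeo_iter alpha).
Local Notation N := (seq_norm tau alpha).
Local Notation T := (weighted_shift_fun alpha w).
Local Notation S := (unshift alpha w).

Definition admissible (J : nat) (eps : int -> R) (K : int -> set R) :=
  forall j : int, - J%:Z <= j <= J%:Z ->
    [/\ 0 < eps j < 1, compact (K j) &
      K j `<=` (fun t => modulus ((tau \o h j) t)) @^-1` `[0, eps j]].

Definition products_vanish (J : nat) (K : int -> set R) :=
  exists r : nat -> nat, {homo r : m n / (m < n)%N} /\
    forall j : int, - J%:Z <= j <= J%:Z ->
      ((fun k : nat => sup [set modulus (forward_prod alpha w j (r k) t) | t in K j])
        @ \oo --> (0 : R)) /\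
      ((fun k : nat => sup [set modulus (backward_prod alpha w j (r k) t) | t in K j])
        @ \oo --> (0 : R)).

Lemma forward_prod_le j r t : modulus (forward_prod alpha w j r t) <= Defs.w_sup w ^+ r.
Proof. by apply: modulus_prod_le => i; exact: w_sup_ub. Qed.

Lemma backward_prod_le j r t : modulus (backward_prod alpha w j r t) <=
  Defs.w_sup (fun j x => (w j x)^-1) ^+ r.
Proof.
by apply: modulus_prod_le => i; exact: (w_sup_ub (w := fun j x => (w j x)^-1)).
Qed.

Lemma homo_ltn_geid (r : nat -> nat) : {homo r : m n / (m < n)%N} ->
  forall n, (n <= r n)%N.
Proof. by move=> rm; elim=> // n IH; apply: leq_ltn_trans IH (rm _ _ _). Qed.

Lemma fin_Csupp_admissible s t : fin_Csupp tau alpha s -> fin_Csupp tau alpha t ->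
  exists J eps K, [/\ admissible J eps K,
    forall j, (J < `|j|)%N -> s j = (fun=> 0) /\ t j = fun=> 0 &
    forall j x, ~ K j x -> s j x = 0 /\ t j x = 0].
Proof.
move=> [sC [J sJ]] [tC [L tL]].
have /choice[q qP] : forall j, exists q : R * set R,
    Csupp_in (tau \o h j) (s j) q.2 q.1 /\ Csupp_in (tau \o h j) (t j) q.2 q.1.
  move=> j; have [_ [K [e sK]]] := sC j; have [_ [M [d tM]]] := tC j.
  have [e01 cK Ke _] := sK; have [d01 cM Md _] := tM.
  exists (Num.max e d, K `|` M); split; first exact: Csupp_inUl.
  exact: Csupp_inUr.
exists (maxn J L), (fst \o q), (snd \o q); split.
- by move=> j _; have [[]] := qP j.
- by move=> j; rewrite gtn_max => /andP[/sJ ? /tL].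
- by move=> j x nx; have [[_ _ _ ->//] [_ _ _ ->//]] := qP j.
Qed.

Lemma seq_norm_ubound s : c0_set tau alpha s ->
  exists2 M, 0 <= M & forall j, (N s j <= M%:E)%E.
Proof.
move=> sc; have [M sM] := seq_norm_bounded (MkC0 (mem_set sc)).
exists M => //; rewrite -lee_fin; exact: le_trans (seq_norm_ge0 _ _ _ 0) (sM 0).
Qed.

(* A common sequence of exponents serves [s] and [t]: admissible compact sets
   containing the supports of both are fed to the hypothesis. *)
Lemma iterates_small s t (d : R) (n : nat) :
  (forall J eps K, admissible J eps K -> products_vanish J K) ->
  fin_Csupp tau alpha s -> fin_Csupp tau alpha t -> 0 < d ->
  exists2 r, (n < r)%N &
    forall j, (N (iter r T s) j <= d%:E)%E /\ (N (iter r S t) j <= d%:E)%E.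
Proof.
move=> crit sC tC d0.
have [J [eps [K [/crit[r [rm rJ]] stJ stK]]]] := fin_Csupp_admissible sC tC.
have [M M0 sM] := seq_norm_ubound (fin_Csupp_c0 sC).
have [L L0 tL] := seq_norm_ubound (fin_Csupp_c0 tC).
(* Products at most [e] bring norms bounded by [M] or [L] below [d]; adding 1 keeps the denominator
   positive. *)
pose e := d / (M + L + 1).
have D0 : 0 < M + L + 1 by lra.
have e0 : 0 < e by rewrite divr_gt0.
(* The indices from -J to J are coded as [i - J] with [i < 2J + 1], so that finitely many limits
   yield one common [k]. *)
have small : \forall k \near \oo, forall i : 'I_(J + J).+1, forall x,
    let j := i%:Z - J%:Z in K j x ->
    modulus (forward_prod alpha w j (r k) x) <= e /\
    modulus (backward_prod alpha w j (r k) x) <= e.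
  apply: filter_forall => i; have [|/cvgr0_norm_le/(_ _ e0) f /cvgr0_norm_le/(_ _ e0) b] :=
    rJ (i%:Z - J%:Z); first by have := ltn_ord i; lia.
  near=> k => x j Kx; split.
    apply: (@le_trans _ _ (sup [set modulus (forward_prod alpha w j (r k) t) | t in K j])).
      exact: (le_sup_image (M := Defs.w_sup w ^+ r k)) (forward_prod_le _ _) Kx.
    by apply: le_trans (ler_norm _) _; near: k.
  apply: (@le_trans _ _ (sup [set modulus (backward_prod alpha w j (r k) t) | t in K j])).
    exact: le_sup_image (backward_prod_le _ _) Kx.
  by apply: le_trans (ler_norm _) _; near: k.
have [k0 _ {}small] := small.
(* Strict growth gives [k <= r k], so [n.+1] forces [n < r k]. *)
pose k := maxn k0 n.+1.
exists (r k).
  by apply: leq_trans (homo_ltn_geid rm _); rewrite leq_maxr.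
have {}small j x : (`|j| <= J)%N -> K j x ->
    modulus (forward_prod alpha w j (r k) x) <= e /\
    modulus (backward_prod alpha w j (r k) x) <= e.
  move=> jJ; have jJ' : (`|(j + J%:Z)%R| < (J + J).+1)%N by lia.
  have := small k (leq_maxl _ _) (Ordinal jJ') x => /=.
  by rewrite (_ : `|(j + J%:Z)%R|%N%:Z - J%:Z = j)//; lia.
have bound (u : int -> R -> R[i]) B : 0 <= B -> B <= M + L -> (forall j, (N u j <= B%:E)%E) ->
    forall j, (e%:E * N u j <= d%:E)%E.
  move=> B0 BM uB j; apply: (@le_trans _ _ (e%:E * B%:E)%E).
    by apply: lee_wpmul2l; [rewrite lee_fin ltW|exact: uB].
  rewrite -EFinM lee_fin /e mulrAC ler_pdivrMr// ler_pM2l//; lra.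
(* Off the supports the products are uncontrolled, but the entry that they multiply is zero. *)
have prod_le (p z : R[i]) : (z = 0 \/ modulus p <= e) -> modulus (p * z) <= e * modulus z.
  rewrite ComplexField.Normc.normcM => -[->|pe]; last by rewrite ler_wpM2r ?modulus_ge0.
  by rewrite ComplexField.Normc.normc0 !mulr0.
move=> j; split.
  rewrite -[j](subrK (r k)%:Z).
  apply: le_trans (seq_norm_iter_shift _ (ltW e0) _) _; last first.
    by apply: bound sM _ => //; lra.
  move=> x; apply: prod_le; set i := j - _.
  have [/stJ[-> _]|iJ] := ltnP J `|i|; first by left.
  have [Kx|/stK[-> _]] := pselect (K i x); last by left.
  by right; have [] := small i x iJ Kx.
rewrite -[j](addrK (r k)%:Z).
apply: le_trans (seq_norm_iter_unshift _ (ltW e0) _) _; last first.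
  by apply: bound tL _ => //; lra.
move=> x; apply: prod_le; set i := j + _.
have [/stJ[_ ->]|iJ] := ltnP J `|i|; first by left.
have [Kx|/stK[_ ->]] := pselect (K i x); last by left.
by right; have [] := small i x iJ Kx.
Unshelve. all: by end_near.
Qed.

End criterion.

(** * Norm estimates and density in the sequence space *)

Section c0_topology.
Context {R : realType} {tau : R -> R[i]} {alpha : homeo R}.
Local Notation X := (c0 tau alpha).
Implicit Types s t : X.

Lemma ler_c0_normD s t : c0_norm (s + t) <= c0_norm s + c0_norm t.
Proof. by rewrite -lecR rmorphD -!c0_normrE ler_normD. Qed.

Lemma c0_norm_distC s t : c0_norm (s - t) = c0_norm (t - s).
Proof. by apply: complexI; rewrite -!c0_normrE distrC. Qed.

Lemma ler_c0_distD u s t : c0_norm (s - t) <= c0_norm (s - u) + c0_norm (u - t).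
Proof. by rewrite -{1}(subrK u s) -addrA ler_c0_normD. Qed.

Lemma c0_norm0 : c0_norm (0 : X) = 0.
Proof. by apply: complexI; rewrite -c0_normrE normr0. Qed.

Lemma c0_norm_gt0 s : s != 0 -> 0 < c0_norm s.
Proof. by rewrite -ltcR -c0_normrE normr_gt0. Qed.

Lemma c0_normrZ (c : R) s : c0_norm (c%:C *: s) = `|c| * c0_norm s.
Proof. by apply: complexI; rewrite -c0_normrE normrZ modulusE modulus_real rmorphM. Qed.

Lemma modulus_le_c0_norm s j x : modulus (c0_seq s j x) <= c0_norm s.
Proof.
rewrite -lee_fin; apply: le_trans (seq_norm_le_c0_norm s j).
exact: le_trans (supnorm_ub _ x) (supnorm_le_segal_norm _ _).
Qed.

Lemma c0_denseP (D : set X) : dense D <->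
  forall y (e : R), 0 < e -> exists2 x, D x & c0_norm (y - x) < e.
Proof.
split=> [dD y e e0|h O [y Oy] oO].
  have eC : 0 < e%:C by rewrite ltcR.
  have nb := nbhs_interior (nbhsx_ballx y _ eC).
  have [|x [/interior_subset xb Dx]] := dD _ _ (open_interior (ball y e%:C)).
    by exists y; exact: nbhs_singleton nb.
  by exists x => //; move: xb; rewrite -ball_normE /= c0_normrE ltcR.
have /nbhs_ballP[e /= e0 eO] := open_nbhs_nbhs (conj oO Oy).
(* Radii are positive elements of [R[i]], hence real. *)
have eE : e = (complex.Re e)%:C by apply/esym/RRe_real/gtr0_real.
have e'0 : 0 < complex.Re e by rewrite -ltcR -eE.
have [x Dx yx] := h y _ e'0; exists x; split=> //.
by apply: eO; rewrite -ball_normE /= c0_normrE eE ltcR.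
Qed.

Lemma infinite_dimensional_neq0 : infinite_dimensional X -> exists s : X, s != 0.
Proof.
move=> inf; apply: contrapT => h; apply: inf; exists 0%N, (fun=> 0) => s.
exists (fun=> 0); rewrite big_ord0; apply: contrapT => /eqP s0.
by apply: h; exists s.
Qed.

(** A nonzero normed space has no isolated points, so a dense set stays dense when one point is
    removed; the induction removes the terms one by one. *)
Lemma dense_tail (u : nat -> X) : infinite_dimensional X ->
  dense (range u) -> forall n, dense [set u k | k in [set k | (n <= k)%N]].
Proof.
move=> /infinite_dimensional_neq0[s s0] du; elim=> [|n /c0_denseP IH].
  move: du; congr dense; apply/seteqP.
  by split=> _ [k _ <-]; exists k.
have sp := c0_norm_gt0 s0.
apply/c0_denseP => y e e0.
have [z zn yz] : exists2 z, z != u n & c0_norm (y - z) < e / 2.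
  have [yE|yn] := eqVneq y (u n); last first.
    by exists y => //; rewrite subrr c0_norm0 divr_gt0.
  (* The coefficient gives a displacement of norm [e / 4], enough to leave [u n]. *)
  exists (y - (e / 4 / c0_norm s)%:C *: s).
    rewrite -yE -subr_eq0 addrAC subrr add0r oppr_eq0 scaler_eq0 negb_or s0 andbT.
    by rewrite -modulus_gt0 modulus_real normr_gt0 gt_eqF// !divr_gt0.
  rewrite opprB addrC subrK c0_normrZ gtr0_norm ?divr_gt0 ?divr_gt0//.
  by rewrite divfK ?gt_eqF//; lra.
(* A point closer to [z] than [u n] is cannot be [u n], so its index exceeds [n]. *)
pose e' := Num.min (e / 2) (c0_norm (z - u n)).
have e'0 : 0 < e' by rewrite lt_min divr_gt0//= c0_norm_gt0// subr_eq0.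
have [_ [k /= nk <-] zk] := IH z _ e'0.
exists (u k).
  exists k => //=; rewrite ltn_neqAle nk andbT; apply/eqP => kn.
  by move: zk; rewrite /e' kn lt_min ltxx andbF.
apply: le_lt_trans (ler_c0_distD z _ _) _; rewrite [ltRHS]splitr ltrD//.
by move: zk; rewrite lt_min => /andP[].
Qed.

End c0_topology.

(** The factor [a] has modulus at least 1/2, so dividing by it costs at most a factor 2. *)
Lemma modulus_factor_le (R : realType) (p a : R[i]) d :
  modulus (1 - a) <= 2^-1 -> modulus (p * a) <= d -> modulus p <= 2 * d.
Proof.
move=> a1; rewrite ComplexField.Normc.normcM => pa.
have : 2^-1 <= modulus a.
  have := modulusD (1 - a) a; rewrite subrK ComplexField.Normc.normc1; lra.
move=> a2; have := ler_wpM2l (modulus_ge0 p) a2; lra.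
Qed.

(** * The two implications *)

Section hypercyclic_criterion.
Context {R : realType} (tau : R -> R[i]) (alpha : homeo R) (w : int -> R -> R[i]).
Hypothesis tau_continuous : continuous tau.
Hypothesis w_Cb : forall j, Cb (w j).
Hypothesis w_neq0 : forall j x, w j x != 0.
Hypothesis w_bounded :
  (ereal_sup [set supnorm (w j) | j in [set: int]] < +oo)%E.
Local Notation X := (c0 tau alpha).
Local Notation h := (homeo_iter alpha).
Local Notation N := (seq_norm tau alpha).
Local Notation T := (weighted_shift tau alpha w w_Cb w_bounded).
Local Notation T0 := (weighted_shift_fun alpha w).
Local Notation S := (unshift alpha w).

Lemma iter_weighted_shiftE n (s : X) : c0_seq (iter n T s) = iter n T0 s.
Proof. by elim: n => //= n ->. Qed.

Lemma hypercyclic_products_vanish J eps K : infinite_dimensional X ->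
  hypercyclic T -> admissible tau alpha J eps K -> products_vanish alpha w J K.
Proof.
move=> inf [x dx] adm.
have /choice[f fP] : forall j, exists f : R -> R[i], [/\ Csupp (tau \o h j) f,
    (`|j| <= J)%N -> forall t, K j t -> f t = 1 & (J < `|j|)%N -> f = fun=> 0].
  move=> j; have [Jj|jJ] := ltnP J `|j|.
    exists (fun=> 0); split=> [|/notF[]|_]; last by [].
    exact: Csupp0.
  have [|e01 cK Ke] := adm j; first by lia.
  have [|f fC f1] := Csupp_bump _ e01 cK Ke; last first.
    by exists f; split=> [|//|/notF[]].
  by move=> t; apply: continuous_comp; [exact: homeo_iter_continuous|exact: tau_continuous].
have fC : fin_Csupp tau alpha f.
  by split=> [j|]; [have [] := fP j|exists J => j; have [] := fP j].
pose v := c0_of fC.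
have f0 j t : (J < `|j|)%N -> f j t = 0 by move=> Jj; have [_ _ ->] := fP j.
have key (d : R) n : 0 < d -> d <= 2^-1 -> exists2 r, (n < r)%N &
    forall j t, (`|j| <= J)%N -> K j t ->
      modulus (forward_prod alpha w j r t) <= 2 * d /\
      modulus (backward_prod alpha w j r t) <= 2 * d.
  move=> d0 d2.
  have near_v m : exists2 k, (m <= k)%N & c0_norm (v - iter k T x) < d.
    have [_ [k mk <-] vk] := proj1 (c0_denseP _) (dense_tail inf dx m) v _ d0.
    by exists k.
  have [n1 _ vn1] := near_v 0%N.
  (* The gap makes [r > n + 2J], so for |j| <= J both [j + r] and [j - r] lie outside [-J, J], where
     [v] is zero. *)
  have [n2 n12 vn2] := near_v (n1 + (n + J + J).+1)%N.
  have [r rE n2E] : exists2 r, (n + J + J < r)%N & n2 = (r + n1)%N.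
    by exists (n2 - n1)%N; lia.
  exists r; first by lia.
  move: vn2; rewrite n2E iterD; set s := iter n1 T x in vn1 * => vn2.
  have b1 j t : modulus (f j t - c0_seq s j t) <= d.
    exact: le_trans (modulus_le_c0_norm (v - s) j t) (ltW vn1).
  have b2 j t : modulus (f j t - iter r T0 s j t) <= d.
    rewrite -iter_weighted_shiftE.
    exact: le_trans (modulus_le_c0_norm (v - iter r T s) j t) (ltW vn2).
  have sE : iter r S (iter r T0 s) = s.
    by apply: iter_cancel => u; exact: unshift_shift.
  move=> j t jJ Kt; have f1 : f j t = 1 by have [_ -> ] := fP j.
  split.
    apply: (modulus_factor_le (a := c0_seq s j t)).
      by apply: le_trans d2; rewrite -f1 b1.
    (* The entry of T^r s at [j + r] is the forward product times [s j], and its distance to the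
       zero entry of [v] is at most [d]. *)
    have := b2 (j + r%:Z) (h (- r%:Z) t).
    by rewrite f0; [rewrite sub0r iter_shiftE modulusN|lia].
  apply: (modulus_factor_le (a := iter r T0 s j t)).
    by apply: le_trans d2; rewrite -f1 b2.
  (* Likewise for s = S^r (T^r s) at [j - r]: its entry is the backward product times that of T^r s
     at [j]. *)
  have := b1 (j - r%:Z) (h r%:Z t).
  by rewrite f0; [rewrite sub0r -{1}sE iter_unshiftE modulusN|lia].
(* The accuracies 1/(k+2) tend to 0 and never exceed the 1/2 that [key] allows. *)
have d0 k : 0 < k.+2%:R^-1 :> R by rewrite invr_gt0.
have d2 k : k.+2%:R^-1 <= 2^-1 :> R by rewrite lef_pV2 ?posrE ?ltr0n// ler_nat.
have /choice[F FP] : forall q : nat * nat, exists r, (q.2 < r)%N /\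
    forall j t, (`|j| <= J)%N -> K j t ->
      modulus (forward_prod alpha w j r t) <= 2 * q.1.+2%:R^-1 /\
      modulus (backward_prod alpha w j r t) <= 2 * q.1.+2%:R^-1.
  by move=> q; have [r ? ?] := key _ q.2 (d0 q.1) (d2 q.1); exists r.
(* Each exponent is chosen beyond the previous one, which makes the sequence strictly increasing. *)
pose r := fix r k := if k is k'.+1 then F (k, r k') else F (0%N, 0%N).
have rP k j t : (`|j| <= J)%N -> K j t ->
    modulus (forward_prod alpha w j (r k) t) <= 2 * k.+2%:R^-1 /\
    modulus (backward_prod alpha w j (r k) t) <= 2 * k.+2%:R^-1.
  by case: k => [|k]; [have [_] := FP (0%N, 0%N)|have [_] := FP (k.+1, r k)]; exact.
exists r; split.
  by apply: homo_ltn => [? ? ?|k]; [exact: ltn_trans|have [] := FP (k.+1, r k)].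
have cv (g : nat -> R -> R) (L : set R) :
    (forall k t, L t -> 0 <= g k t <= 2 * k.+2%:R^-1) ->
    (fun k => sup [set g k t | t in L]) @ \oo --> (0 : R).
  move=> gL; apply/cvgr0Pnorm_le => e e0; exists (Num.truncn (2 / e)) => // k /= ek.
  have /andP[s0 sk] : 0 <= sup [set g k t | t in L] <= 2 * k.+2%:R^-1.
    by apply: sup_image_bounds (gL k); rewrite mulr_ge0// ltW.
  rewrite ger0_norm// (le_trans sk)// ler_pdivrMr// -ler_pdivrMl// mulrC ltW//.
  by apply: lt_le_trans (truncnS_gt _) _; rewrite ler_nat ltnS (leq_trans ek).
move=> j jJ; split; apply: cv => k t Kt; rewrite modulus_ge0/=.
  by have [|] := rP k j t _ Kt; first lia.
by have [|] := rP k j t _ Kt; first lia.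
Qed.

Lemma iter_weighted_shift_le (C : R) : 0 <= C ->
    (forall j x, modulus (w j x) <= C) ->
  forall n (s : X), c0_norm (iter n T s) <= C ^+ n * c0_norm s.
Proof.
move=> C0 wC; elim=> [|n IH] s; first by rewrite expr0 mul1r.
apply: (@le_trans _ _ (C * c0_norm (iter n T s))); last first.
  by rewrite exprS -mulrA ler_wpM2l.
apply: c0_norm_le => j; rewrite EFinM.
apply: (@le_trans _ _ (C%:E * N (iter n T s) (j - 1))%E).
  by rewrite /seq_norm homeo_iter_pred compA; exact: segal_norm_weight.
by apply: lee_wpmul2l; [rewrite lee_fin|exact: seq_norm_le_c0_norm].
Qed.

(** The entry [m] is constant from step |m| on, so the limit is read off the diagonal. At each [m]
    it agrees with [u (k + |m|)], hence inherits the bound [b k], and uniform closeness to some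
    [u k] gives the decay at infinity. *)
Lemma c0_eventually_constant_limit (u : nat -> X) (b : nat -> R) :
  (forall k n, c0_norm (u (k + n)%N - u k) <= b k) ->
  (forall e : R, 0 < e -> exists k, b k <= e) ->
  (forall k m, - k%:Z <= m -> c0_seq (u k.+1) m = c0_seq (u k) m) ->
  exists x : X, forall k, c0_norm (x - u k) <= b k.
Proof.
move=> ub b0 uE.
pose x (m : int) := c0_seq (u `|m|%N) m.
have xE m n : c0_seq (u (`|m| + n)%N) m = x m.
  elim: n => [|n IH]; first by rewrite addn0.
  by rewrite addnS uE ?IH//; lia.
have xu m k : (N (fun j t => x j t - c0_seq (u k) j t)%R m <= (b k)%:E)%E.
  apply: (@le_trans _ _ (c0_norm (u (k + `|m|)%N - u k))%:E); last by rewrite lee_fin.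
  rewrite /seq_norm -(xE m k) addnC.
  exact: (seq_norm_le_c0_norm (u (k + `|m|)%N - u k)).
have xc : c0_set tau alpha x.
  apply/c0_setP; split=> [m|e e0].
    by have [] := c0P (u `|m|%N).
  have e20 : 0 < e / 2 by rewrite divr_gt0.
  have [k bk] := b0 _ e20.
  have /c0_setP[_ /(_ _ e20)[J uJ]] := c0P (u k).
  exists J => m Jm.
  have -> : N x m = segal_norm (tau \o h m)
      (fun t => (x m t - c0_seq (u k) m t) + c0_seq (u k) m t)%R.
    by apply: segal_norm_eq => t; rewrite subrK.
  apply: le_trans (segal_normD _ _ _) _; rewrite [e]splitr EFinD; apply: leeD.
    by apply: le_trans (xu m k) _; rewrite lee_fin.
  exact: uJ.
by exists (MkC0 (mem_set xc)) => k; apply: c0_norm_le => m; exact: xu.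
Qed.

(* [v] approximates the target [y]; the correction [u' - u] is [T^-r v], whose
   support has been pushed below [-k] so that it settles the entries [m >= -k]. *)
Lemma hypercyclic_step (k rho : nat) (u y : X) (d C : R) :
  (forall J eps K, admissible tau alpha J eps K -> products_vanish alpha w J K) ->
  (ereal_sup [set supnorm (fun x => (w j x)^-1)%R | j in [set: int]] < +oo)%E ->
  fin_Csupp tau alpha u -> 0 < d -> 1 <= C ->
  exists u' : X, exists r : nat,
    [/\ fin_Csupp tau alpha u' /\ (rho < r)%N,
        c0_norm (iter r T u) <= d,
        c0_norm (u' - u) <= d / C ^+ rho,
        c0_norm (iter r T (u' - u) - y) <= d &
        forall m, - k%:Z <= m -> c0_seq u' m = c0_seq u m].
Proof.
move=> crit winv uC d0 C1.
have w_continuous j : continuous (w j) by have [] := w_Cb j.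
have [v vC yv] := fin_Csupp_dense y tau_continuous d0.
have [_ [J vJ]] := vC.
have Crho : 0 < C ^+ rho by rewrite exprn_gt0// (lt_le_trans ltr01).
have dC0 : 0 < d / C ^+ rho by rewrite divr_gt0.
have dC : d / C ^+ rho <= d.
  by rewrite ler_pdivrMr// ler_peMr ?exprn_ege1// ltW.
(* The margin [J + k] clears the support of [v] past [-k], and [rho] makes the exponents increase.
   The accuracy d / C^rho survives the [rho]-th power of the shift. *)
have [r rn small] := iterates_small w_bounded winv (rho + J + k)%N crit uC vC dC0.
have zC : fin_Csupp tau alpha (iter r S v) by exact: fin_Csupp_iter_unshift.
pose z := c0_of zC; have zE : u + z - u = z by rewrite addrC addKr.
exists (u + z), r; split.
- split; first exact: fin_CsuppD; lia.
- apply: le_trans dC; apply: c0_norm_le => j.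
  by rewrite iter_weighted_shiftE; have [] := small j.
- by rewrite zE; apply: c0_norm_le => j; have [] := small j.
- rewrite zE (_ : iter r T z = v) 1?c0_norm_distC//.
  by apply: val_inj => /=; rewrite iter_weighted_shiftE iter_shift_unshift.
- move=> m km; have z0 : c0_seq z m = fun=> 0.
    by apply: (iter_unshift_eq0 alpha w vJ); lia.
  rewrite -[LHS]/(fun t => c0_seq u m t + c0_seq z m t) z0.
  by apply/funext => t; rewrite addr0.
Qed.

Lemma products_vanish_hypercyclic :
  (forall J eps K, admissible tau alpha J eps K -> products_vanish alpha w J K) ->
  (ereal_sup [set supnorm (fun x => (w j x)^-1)%R | j in [set: int]] < +oo)%E ->
  separable X -> infinite_dimensional X -> hypercyclic T.
Proof.
move=> crit winv [D cD dD] inf.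
(* At least 1, so that the powers of [C] increase with the exponent. *)
pose C : R := Num.max 1 (Defs.w_sup w).
have C1 : 1 <= C by rewrite le_max lexx.
have C0 : 0 < C by exact: lt_le_trans C1.
have wC j x : modulus (w j x) <= C by rewrite le_max w_sup_ub// orbT.
have [e De] : exists e : nat -> X, D `<=` range e.
  have /pfcard_geP[->|[f]] := cD.
    by exists (fun=> 0) => ? [].
  by exists f => s Ds; have [n _ <-] := @surj _ _ _ _ f s Ds; exists n.
have {D cD dD De} de : dense (range e).
  by move=> O O0 oO; have [s [Os Ds]] := dD O O0 oO; exists s; split=> //; exact: De.
pose d k : R := 2^-1 ^+ k.
have d0 k : 0 < d k by rewrite exprn_gt0// invr_gt0.
have d2 k : 2 * d k.+1 = d k by rewrite /d exprS mulVKf.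
have telescope (a b : R) : a + (b - 2 * a) = b - a by ring.
have sum3 (a b : R) : 0 < b -> a < b / 8 -> a + (a + a) < b / 2 by lra.
(* [q] holds the step number, the partial sum and the last exponent; [q'] the next sum and exponent.
   The premise makes [P] satisfiable for every [q], as choice requires. *)
pose P (q : nat * (X * nat)) (q' : X * nat) := fin_Csupp tau alpha q.2.1 ->
  [/\ fin_Csupp tau alpha q'.1 /\ (q.2.2 < q'.2)%N,
      c0_norm (iter q'.2 T q.2.1) <= d q.1,
      c0_norm (q'.1 - q.2.1) <= d q.1 / C ^+ q.2.2,
      c0_norm (iter q'.2 T (q'.1 - q.2.1) - e q.1) <= d q.1 &
      forall m, - q.1%:Z <= m -> c0_seq q'.1 m = c0_seq q.2.1 m].
have /choice[F FP] : forall q, exists q', P q q'.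
  move=> [k [u rho]]; have [uC|nuC] := pselect (fin_Csupp tau alpha u); last by exists (u, rho).
  have [u' [r h]] := hypercyclic_step k rho (e k) crit winv uC (d0 k) C1.
  by exists (u', r).
pose p := fix p k : X * nat := if k is k'.+1 then F (k', p k') else (0, 0%N).
pose u k := (p k).1; pose rho k := (p k).2.
have uC k : fin_Csupp tau alpha (u k).
  elim: k => [|k IH]; last by have [[]] := FP (k, p k) IH.
  by split=> [j|]; [exact: Csupp0|exists 0%N].
have step k := FP (k, p k) (uC k).
have rho_le k n : (rho k <= rho (k + n)%N)%N.
  elim: n => [|n IH]; first by rewrite addn0.
  by rewrite addnS; have [[_ /ltnW]] := step (k + n)%N; move=> /(leq_trans IH).
have uB k n : c0_norm (u (k + n)%N - u k) <= 2 * d k / C ^+ rho k.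
  (* The sharper bound is the exact sum of [d i] for k <= i < k + n, which lets the induction
     telescope. *)
  suff: c0_norm (u (k + n)%N - u k) <= (2 * d k - 2 * d (k + n)%N) / C ^+ rho k.
    move=> /le_trans; apply; rewrite ler_wpM2r ?invr_ge0 ?exprn_ge0 ?(ltW C0)//.
    by rewrite gerBl mulr_ge0// ltW.
  elim: n => [|n IH]; first by rewrite addn0 !subrr mul0r c0_norm0.
  apply: le_trans (ler_c0_distD (u (k + n)%N) _ _) _.
  have [_ _ uS _ _] := step (k + n)%N.
  have {}uS : c0_norm (u (k + n.+1)%N - u (k + n)%N) <= d (k + n)%N / C ^+ rho k.
    rewrite addnS; apply: le_trans uS _; apply: ler_wpM2l; first exact: ltW.
    by rewrite lef_pV2 ?posrE ?exprn_gt0//; apply: ler_weXn2l => //; exact: rho_le.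
  apply: le_trans (lerD uS IH) _; rewrite -mulrDl ler_wpM2r ?invr_ge0 ?exprn_ge0 ?(ltW C0)//.
  by rewrite addnS d2 telescope.
have d_small (eps : R) : 0 < eps -> exists k0, forall k, (k0 <= k)%N -> d k < eps.
  move=> eps0; have /cvgr0_norm_lt/(_ _ eps0)[k0 _ h] : geometric 1 2^-1 @ \oo --> (0 : R).
    by apply: cvg_geometric; rewrite gtr0_norm ?invr_gt0// invf_lt1// ltr1n.
  exists k0 => k /h /=; rewrite mul1r; exact: le_lt_trans (ler_norm _).
have [x xu] : exists x : X, forall k, c0_norm (x - u k) <= 2 * d k / C ^+ rho k.
  apply: c0_eventually_constant_limit uB _ _ => [eps eps0|k m km].
    have [|k0 /(_ k0 (leqnn _)) dk] := d_small (eps / 2); first by rewrite divr_gt0.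
    exists k0; rewrite ler_pdivrMr ?exprn_gt0//.
    apply: (@le_trans _ _ eps); first by rewrite mulrC -ler_pdivlMr// ltW.
    by rewrite ler_peMr ?exprn_ege1// ltW.
  by have [_ _ _ _] := step k; exact.
exists x; apply/c0_denseP => y eps eps0.
have [|k0 dk0] := d_small (eps / 8); first by rewrite divr_gt0.
(* Density of the tail gives a [k] for which [e k] is near [y] and [d k] is small at once. *)
have [|_ [k /= k0k <-] yk] := proj1 (c0_denseP _) (dense_tail inf de k0) y (eps / 2).
  by rewrite divr_gt0.
have {dk0} dk := dk0 k k0k.
pose r := rho k.+1; exists (iter r T x); first by exists r.
have [_ Tu _ Tz _] := step k.
have iterB (a b : X) : iter r T (a - b) = iter r T a - iter r T b.
  by elim: (r) => //= n ->; rewrite linearB.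
(* All later corrections together are at most 2 d_{k+1} / C^r, and T^r enlarges them by at most C^r,
   leaving d_k. *)
have Tx : c0_norm (iter r T x - iter r T (u k.+1)) <= d k.
  rewrite -iterB; apply: le_trans (iter_weighted_shift_le (ltW C0) wC _ _) _.
  apply: le_trans (ler_wpM2l _ (xu k.+1)) _; first by rewrite exprn_ge0// ltW.
  rewrite mulrC divfK ?gt_eqF ?exprn_gt0//.
  by rewrite d2.
move: Tz; rewrite [iter _ _ _]iterB => Tz.
apply: le_lt_trans (ler_c0_distD (e k) _ _) _; rewrite [ltRHS]splitr ltrD//.
rewrite c0_norm_distC; apply: le_lt_trans (ler_c0_distD (iter r T (u k.+1)) _ _) _.
apply: (@le_lt_trans _ _ (d k + (d k + d k))); last exact: sum3 eps0 dk.
apply: lerD => //.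
(* The newest correction is sent near [e k], while T^r makes the earlier sum [u k] small. *)
rewrite (_ : _ - e k = iter r T (u k.+1) - iter r T (u k) - e k + iter r T (u k)).
  by apply: le_trans (ler_c0_normD _ _) _; exact: lerD.
by rewrite addrAC subrK.
Qed.

End hypercyclic_criterion.

Unset Implicit Arguments.

Theorem theorem3p7 (R : realType) (tau : R -> R[i]) (tau_Cb : Cb tau)
    (alpha : homeo R) (w : int -> R -> R[i])
    (w_Cb : forall j : int, Cb (w j))
    (w_gt0 : forall (j : int) (x : R), 0 < w j x)
    (w_bounded :
      (ereal_sup [set supnorm (w j) | j in [set: int]] < +oo)%E)
    (winv_bounded :
      (ereal_sup [set supnorm (fun x => (w j x)^-1)%R | j in [set: int]]
        < +oo)%E)
    (c0_separable : separable (c0 tau alpha))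
    (c0_infinite_dimensional : infinite_dimensional (c0 tau alpha)) :
  hypercyclic (weighted_shift tau alpha w w_Cb w_bounded)
  <->
  (forall (J : nat) (eps : int -> R) (K : int -> set R),
    (forall j : int, - J%:Z <= j <= J%:Z ->
      [/\ 0 < eps j < 1, compact (K j) &
        K j `<=` (fun t => modulus ((tau \o homeo_iter alpha j) t))
                   @^-1` `[0, eps j]]) ->
    exists r : nat -> nat, {homo r : m n / (m < n)%N} /\
      forall j : int, - J%:Z <= j <= J%:Z ->
        ((fun k : nat => sup [set
            modulus (\prod_(1 <= i < (r k).+1)
              (w (i%:Z + j) \o homeo_iter alpha (- i%:Z)) t) | t in K j])
          @ \oo --> (0 : R)) /\
        ((fun k : nat => sup [set
            modulus (\prod_(1 <= i < (r k).+1)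
              ((w (j + 1 - i%:Z) \o homeo_iter alpha (i%:Z - 1)) t)^-1)
            | t in K j])
          @ \oo --> (0 : R))).
Proof.
have w_neq0 j x : w j x != 0 by exact: lt0r_neq0.
have [tau_continuous _] := tau_Cb.
(* Both sides of the criterion are convertible with [admissible] and [products_vanish]. *)
split=> [hyp J eps K adm|crit].
  exact: (hypercyclic_products_vanish tau_continuous w_neq0
    c0_infinite_dimensional hyp adm).
exact: (products_vanish_hypercyclic tau_continuous w_Cb w_neq0 w_bounded crit winv_bounded).
Qed.
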